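(* For every $r\in(0,1)$, the measure $m_r=\mu_r+\nu_r$ is an extreme point of $\mathcal{C}$, the convex set of all coherent distributions on $[0,1]^2$.
   Context: Coherent distributions. A random vector $(X_1,X_2)$ defined on some arbitrary probability space $(\Omega,\mathcal{F},\mathbb{P})$ is coherent if there exist an event $E\in\mathcal{F}$ and sub-$\sigma$-fields $\mathcal{G}_1,\mathcal{G}_2\subset\mathcal{F}$ such that $X_i=\mathbb{P}(E\mid\mathcal{G}_i)$ almost surely for $i=1,2$. $\mathcal{C}$ denotes the family of all Borel probability measures on $[0,1]^2$ that are the joint distribution of some coherent vector $(X_1,X_2)$ (on some probability space). The family $\mathcal{C}$ is a convex subset of the set of all Borel probability measures on $[0,1]^2$. The measures. For $r\in(0,1)$ let $t_r:[0,r]\to[0,r]$, $t_r(x)=2\min\{x,r-x\}$, and let $$\Delta_r=\{(x,x):x\in[0,r]\},\qquad \Gamma_r=\{(x,t_r(x)):x\in[0,r]\}.$$ Let $c_r=\int_0^r\left(\frac{s}{1-s}+1\right)\mathrm{d}s=-\log(1-r)<\infty$. The nonnegative Borel measures $\mu_r$ and $\nu_r$ on $[0,1]^2$ are supported on $\Delta_r$ and $\Gamma_r$ respectively, and are defined by $$\mu_r\left(\{(s,s):0\le s\le x\}\right)=c_r^{-1}\int_0^x\frac{s}{1-s}\,\mathrm{d}s,\qquad \nu_r\left(\{(s,t_r(s)):0\le s\le x\}\right)=c_r^{-1}\int_0^x 1\,\mathrm{d}s$$ for all $x\in[0,r]$. Finally $m_r=\mu_r+\nu_r$. *)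

(* Defs.v *)
From HB Require Import structures.
From mathcomp Require Import all_boot all_order all_algebra.
From mathcomp Require Import all_classical all_reals all_analysis.
From mathcomp Require Import measurable_realfun.

Set Implicit Arguments.
Unset Strict Implicit.
Unset Printing Implicit Defensive.

Import Order.TTheory GRing.Theory Num.Theory.
Import numFieldNormedType.Exports.

Local Open Scope classical_set_scope.
Local Open Scope ring_scope.

Section conditional_probability.
Local Open Scope ereal_scope.
Context {d : measure_display} {T : measurableType d} {R : realType}.
Implicit Types (P : probability T R) (E : set T) (G : set_system T).

Definition sub_sigma_field G :=
  sigma_algebra [set: T] G /\ G `<=` measurable.

Definition cond_prob_version P E G (Y : T -> R) :=
  [/\ forall B : set R, measurable B -> G (Y @^-1` B),
      P.-integrable [set: T] (EFin \o Y) &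
      forall A, G A -> \int[P]_(w in A) (Y w)%:E = P (E `&` A)].

(* [G] need not contain the null sets of [P], hence a variable that is almost
   surely equal to a version need not be [G]-measurable itself. *)
Definition is_cond_prob P E G (Z : T -> R) :=
  exists2 Y, cond_prob_version P E G Y & {ae P, forall w, Z w = Y w}.

Definition coherent_vector P (X : {RV P >-> (R * R)%type}) :=
  exists E G1 G2,
    [/\ measurable E, sub_sigma_field G1, sub_sigma_field G2,
        is_cond_prob P E G1 (fun w => (X w).1) &
        is_cond_prob P E G2 (fun w => (X w).2)].

End conditional_probability.

Section coherent_distributions.
Local Open Scope ereal_scope.
Context (R : realType).

Definition unit_square : set (R * R) := `[0%R, 1%R] `*` `[0%R, 1%R].

(* Borel probability measures on the unit square are represented by the Borel
   measures on the plane that give mass 1 both to the plane and to the square.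
   Equality of measures is only meaningful on measurable sets. *)
Definition coherent : set {measure set (R * R)%type -> \bar R} :=
  [set m | [/\ m [set: R * R] = 1, m unit_square = 1 &
    exists (d : measure_display) (T : measurableType d) (P : probability T R)
           (X : {RV P >-> (R * R)%type}),
      coherent_vector X /\
      forall A, measurable A -> m A = distribution P X A]].

End coherent_distributions.
Arguments coherent {R}.

Definition extreme_point {d : measure_display} {T : measurableType d}
    {R : realType} (C : set {measure set T -> \bar R})
    (m : {measure set T -> \bar R}) :=
  C m /\
  forall (m1 m2 : {measure set T -> \bar R}) (t : R),
    C m1 -> C m2 -> 0 < t < 1 ->
    (forall A, measurable A -> m A = t%:E * m1 A + (1 - t)%:E * m2 A)%E ->
    forall A, measurable A -> m1 A = m A /\ m2 A = m A.

Section the_measures.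
Context {R : realType}.
Implicit Types (r x s : R) (m : {measure set (R * R)%type -> \bar R}).

Definition tent r x : R := 2 * Num.min x (r - x).

Definition diag_upto x : set (R * R) := [set (s, s) | s in `[0, x]].

Definition tent_graph_upto r x : set (R * R) :=
  [set (s, tent r s) | s in `[0, x]].

Definition norm_const r : R :=
  \int[lebesgue_measure]_(s in `[0, r]) (s / (1 - s) + 1).

Definition is_mu r m :=
  m (~` diag_upto r) = 0%E /\
  forall x, 0 <= x <= r ->
    m (diag_upto x) =
    ((norm_const r)^-1 *
     \int[lebesgue_measure]_(s in `[0, x]) (s / (1 - s)))%:E.

Definition is_nu r m :=
  m (~` tent_graph_upto r r) = 0%E /\
  forall x, 0 <= x <= r ->
    m (tent_graph_upto r x) =
    ((norm_const r)^-1 * \int[lebesgue_measure]_(s in `[0, x]) 1)%:E.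

End the_measures.

Section existence.
Context {R : realType}.
Local Notation leb := (@lebesgue_measure R).

Let graph_measure_exists (g f : R -> R) (c r : R) :
  0 <= c -> measurable_fun [set: R] g ->
  leb.-integrable `[0, r] (EFin \o f) ->
  (forall x, x \in `[0, r] -> 0 <= f x) ->
  exists m : {measure set (R * R)%type -> \bar R},
    m (~` [set (s, g s) | s in `[0, r]]) = 0%E /\
    forall x, 0 <= x <= r ->
      m [set (s, g s) | s in `[0, x]] = (c * \int[leb]_(s in `[0, x]) f s)%:E.
Proof.
move=> c0 mg intf f0.
pose h : R -> \bar R := (EFin \o f) \_ `[0, r].
have h0 x : (0 <= h x)%E.
  rewrite /h patchE; case: ifPn => //; rewrite inE/= => xr.
  by rewrite lee_fin f0.
have mh : measurable_fun setT h.
  apply/(measurable_restrictT _ _).1 => //.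
  exact: measurable_int intf.
pose lam (A : set (measurableTypeR R)) : \bar R := (\int[leb]_(x in A) h x)%E.
have lam0 : lam set0 = 0%E by rewrite /lam integral_set0.
have lam_ge0 A : (0 <= lam A)%E by apply: integral_ge0 => x _; exact: h0.
have lamU : semi_sigma_additive lam.
  exact: (@semi_sigma_additive_nng_induced _ (measurableTypeR R) R leb h).
pose phi (x : R) : R * R := (x, g x).
have mphi : measurable_fun [set: R] phi by exact: measurable_fun_pair.
pose M0 (A : set (R * R)) : \bar R := lam (phi @^-1` A).
have M00 : M0 set0 = 0%E by rewrite /M0 preimage_set0.
have M0_ge0 A : (0 <= M0 A)%E by exact: lam_ge0.
have M0U : semi_sigma_additive M0.
  move=> F mF tF mUF; rewrite /M0 preimage_bigcup; apply: lamU.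
  - by move=> n; rewrite -[X in measurable X]setTI; exact: mphi.
  - apply/trivIsetP => i j _ _ ij; rewrite -preimage_setI.
    by move/trivIsetP : tF => ->//; rewrite preimage_set0.
  - by rewrite -preimage_bigcup -[X in measurable X]setTI; exact: mphi.
pose HM := isMeasure.Build _ _ _ M0 M00 M0_ge0 M0U.
pose M : {measure set (R * R)%type -> \bar R} := HB.pack M0 HM.
have preE x : phi @^-1` [set (s, g s) | s in `[0, x]] = `[0, x]%classic.
  apply/seteqP; split => [y /= [s sx [<- _]]//|y yx/=].
  by exists y.
pose N : {measure set (R * R)%type -> \bar R} := mscale (NngNum c0) M.
have mE A : N A = (c%:E * lam (phi @^-1` A))%E by [].
exists N; split.
  rewrite mE (_ : phi @^-1` _ = ~` `[0, r]%classic); last by rewrite -[in RHS]preE.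
  rewrite /lam integral0_eq ?mule0// => x xr.
  by rewrite /h patchE memNset.
move=> x /andP[x0 xr].
rewrite mE preE EFinM; congr (_ * _)%E.
have sub : `[0, x]%classic `<=` `[0, r]%classic.
  by apply: subset_itvl; rewrite bnd_simp.
rewrite /lam /Rintegral fineK; last first.
  by apply: integrable_fin_num => //; exact: integrableS intf.
apply: eq_integral => y; rewrite inE => /sub yr.
by rewrite /h patchE mem_set.
Qed.

Let norm_const_ge0 (r : R) : r < 1 -> 0 <= (norm_const r)^-1.
Proof.
move=> r1; rewrite invr_ge0; apply: Rintegral_ge0 => x /=.
rewrite in_itv/= => /andP[x0 xr].
by rewrite addr_ge0// divr_ge0// subr_ge0; exact: le_trans xr (ltW r1).
Qed.

Lemma is_mu_exists (r : R) : 0 < r < 1 ->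
  exists m : {measure set (R * R)%type -> \bar R}, is_mu r m.
Proof.
move=> /andP[r0 r1].
apply: (@graph_measure_exists id (fun s => s / (1 - s)) (norm_const r)^-1 r).
- exact: norm_const_ge0.
- exact: measurable_id.
- apply: continuous_compact_integrable; first exact: segment_compact.
  apply: continuous_in_subspaceT => x; rewrite inE/= in_itv/= => /andP[x0 xr].
  have x1 : 1 - x != 0 by rewrite subr_eq0 gt_eqF// (le_lt_trans xr).
  apply: cvgM; first exact: cvg_id.
  apply: cvgV => //; apply: cvgB; [exact: cvg_cst|exact: cvg_id].
- move=> x; rewrite in_itv/= => /andP[x0 xr].
  by rewrite divr_ge0// subr_ge0; exact: le_trans xr (ltW r1).
Qed.

Lemma is_nu_exists (r : R) : 0 < r < 1 ->
  exists m : {measure set (R * R)%type -> \bar R}, is_nu r m.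
Proof.
move=> /andP[r0 r1].
apply: (@graph_measure_exists (tent r) (fun=> 1) (norm_const r)^-1 r).
- exact: norm_const_ge0.
- apply: measurable_funM => //; apply: measurable_minr => //.
  exact: measurable_funB.
- apply: continuous_compact_integrable; first exact: segment_compact.
  by apply: continuous_subspaceT => x; exact: cvg_cst.
- by [].
Qed.

End existence.

(* Main.v *)
Require Import Defs.
From HB Require Import structures.
From mathcomp Require Import all_boot all_order all_algebra.
From mathcomp Require Import all_classical all_reals all_analysis.
From mathcomp Require Import measurable_realfun.
From mathcomp Require Import ring lra.

(** Let [D] be the diagonal and [G] the graph of the tent map [t] over [0, r].

    A distribution [m] on the square is coherent exactly when it splits as
    [m = mu + nu], where [mu] is the part carried by the event E, and both
    coordinates satisfy [mu (x_i in B) = int_(x_i in B) x_i dm]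
    ([coherent_decompose], [coherent_of_decomposition]).  Such splittings
    survive convex combinations ([decomposition_convex]).  So if
    [m_r = s m1 + (1 - s) m2] with [m1], [m2] coherent, splittings of [m1] and
    [m2] combine into a splitting [m_r = mu' + nu'].

    The two marginals of [m_r] coincide, because [t] preserves the uniform law
    on [0, r].  Hence the two marginals of [mu'] coincide as well.  The part of
    [mu'] living off [G] lies on [D] and has equal marginals, so the part on
    [G], projected to the first axis, is invariant under [t]
    ([graph_part_tent_invariant]).  It has a bounded density, and a
    [t]-invariant measure with bounded density is a multiple of the uniform law
    ([tent_invariant_measure]).  But the mass that [mu'] gives to [x_1 <= x] is
    at most [x] times the mass given by [m_r], which is of order [x ^ 2]; a
    nonzero multiple of the uniform law would be of order [x].  Thus [mu']
    vanishes on [G], and comparing total masses [nu'] is carried by [G].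

    Consequently [m1] has a splitting [mu1 + nu1] with [mu1] on [D] and [nu1]
    on [G] ([rigid_decomposition]).  The identities for the two coordinates
    give [int_B x dM = int_B x dM'] for the marginals [M], [M'] of [m1], so
    [M = M'], the marginals of [nu1] agree, and [nu1] projects to a
    [t]-invariant measure, that is to a multiple [q] of the projection of
    [nu_r].  As the projection of [nu1] is [(1 - x) M], [M] is [q] times the
    marginal of [m_r], and [q = 1] by total mass; a measure carried by a graph
    is determined by its projection, so [m1 = m_r].

    Ergodicity of the tent map enters only through [dyadic_rigidity], proved by
    an energy argument on the distribution function.  Let V_n(F) be 2^n times
    the sum of the squared increments of [F] over the 2^n dyadic subintervals.
    Convexity makes V_n nondecreasing in n, a Lipschitz bound makes it bounded.
    Invariance writes [F] as the sum of the contributions [F1], [F2] of the two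
    branches of [t], and the parallelogram law gives
    V_(n+1)(F) = V_n(F) + V_n(F1 - F2).  So V_n(F1 - F2) is summable in n while
    nondecreasing, hence zero: the two preimages of a dyadic interval carry the
    same mass, and induction shows that all dyadic intervals of a given level
    do. *)

Set Implicit Arguments.
Unset Strict Implicit.
Unset Printing Implicit Defensive.

Import Order.TTheory GRing.Theory Num.Theory.
Import numFieldNormedType.Exports.

Local Open Scope classical_set_scope.
Local Open Scope ring_scope.

(** * Energy of increments along dyadic subdivisions *)

Section dyadic_rigidity.
Context {R : realType}.
Implicit Types (r K : R) (F : R -> R) (n k : nat).

Definition dyadic r n k : R := r * (k%:R / 2 ^+ n).

Definition dyadic_incr r F n k : R := F (dyadic r n k.+1) - F (dyadic r n k).

(** The squared L2 norm, up to the factor [r], of the conditional expectation of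
    the density of [F] on dyadic intervals of level [n]. *)
Definition dyadic_energy r F n : R :=
  2 ^+ n * \sum_(k < 2 ^ n) (dyadic_incr r F n k) ^+ 2.

Lemma dyadic0 r n : dyadic r n 0 = 0.
Proof. by rewrite /dyadic mul0r mulr0. Qed.

Lemma dyadic_double r n k : dyadic r n.+1 k.*2 = dyadic r n k.
Proof.
by rewrite /dyadic exprS -muln2 natrM; field; rewrite expf_neq0.
Qed.

Lemma dyadic_half r n k : dyadic r n.+1 k = dyadic r n k / 2.
Proof. by rewrite /dyadic exprS invfM; ring. Qed.

Lemma dyadic_rev r n k : (k <= 2 ^ n)%N ->
  dyadic r n (2 ^ n - k) = r - dyadic r n k.
Proof.
by move=> kn; rewrite /dyadic natrB// natrX mulrBl divff ?mulrBr ?mulr1.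
Qed.

Lemma dyadic_itv r n k : 0 <= r -> (k <= 2 ^ n)%N -> 0 <= dyadic r n k <= r.
Proof.
move=> r0 kn; have e : (0 : R) < 2 ^+ n by rewrite exprn_gt0.
rewrite /dyadic; apply/andP; split.
  by rewrite mulr_ge0// divr_ge0// ltW.
by rewrite -[leRHS]mulr1 ler_wpM2l// ler_pdivrMr// mul1r -natrX ler_nat.
Qed.

Lemma sum_double n (u : nat -> R) :
  \sum_(k < n.*2) u k = \sum_(k < n) (u k.*2 + u k.*2.+1).
Proof.
elim: n => [|n IH]; first by rewrite !big_ord0.
by rewrite doubleS !big_ord_recr/= IH addrA.
Qed.

Lemma dyadic_energy_ge0 r F n : 0 <= dyadic_energy r F n.
Proof.
by rewrite mulr_ge0 ?exprn_ge0// sumr_ge0// => k _; exact: sqr_ge0.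
Qed.

(** Splitting an interval in two halves replaces [(a + b) ^ 2] by
    [2 * (a ^ 2 + b ^ 2)], which is at least as large. *)
Lemma dyadic_energy_nondecreasing r F n :
  dyadic_energy r F n <= dyadic_energy r F n.+1.
Proof.
rewrite /dyadic_energy expnS mul2n (sum_double _ (fun k => dyadic_incr r F n.+1 k ^+ 2)) [2 ^+ n.+1]exprSr -mulrA.
apply: ler_wpM2l; first exact: exprn_ge0.
rewrite mulr_sumr; apply: ler_sum => k _; rewrite /dyadic_incr.
have -> : dyadic r n.+1 k.*2 = dyadic r n k by exact: dyadic_double.
have -> : dyadic r n.+1 k.*2.+2 = dyadic r n k.+1 by exact: (dyadic_double r n k.+1).
set a := F _; set b := F _; set c := F _.
have := sqr_ge0 ((a - c) - (c - b)); nra.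
Qed.

Lemma dyadic_energy_homo r F n n' : (n <= n')%N ->
  dyadic_energy r F n <= dyadic_energy r F n'.
Proof.
move=> /subnK <-; elim: (n' - n)%N => // j; move/le_trans; apply.
exact: dyadic_energy_nondecreasing.
Qed.

Lemma dyadic_energy_bounded r F K n : 0 <= r ->
  (forall x y : R, 0 <= x <= y -> y <= r -> `|F y - F x| <= K * (y - x)) ->
  dyadic_energy r F n <= (K * r) ^+ 2.
Proof.
move=> r0 FK; rewrite /dyadic_energy.
have e : (0 : R) < 2 ^+ n by rewrite exprn_gt0.
have step k : (k < 2 ^ n)%N ->
    (dyadic_incr r F n k) ^+ 2 <= (K * (r / 2 ^+ n)) ^+ 2.
  move=> kn.
  have kk : dyadic r n k.+1 - dyadic r n k = r / 2 ^+ n.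
    by rewrite /dyadic -mulrBr -mulrBl -[k.+1%:R]natr1 addrAC subrr add0r mul1r.
  have H : `|dyadic_incr r F n k| <= K * (r / 2 ^+ n).
    rewrite -kk; apply: FK.
      by have /andP[-> _]/= := dyadic_itv r0 (ltnW kn); rewrite -subr_ge0 kk divr_ge0// ltW.
    by have /andP[] := dyadic_itv r0 kn.
  by rewrite -real_normK ?num_real// ler_sqr// nnegrE (le_trans _ H).
apply: (@le_trans _ _ (2 ^+ n * \sum_(k < 2 ^ n) (K * (r / 2 ^+ n)) ^+ 2)).
  by apply: ler_wpM2l; [exact: ltW|apply: ler_sum => k _; exact: step].
rewrite sumr_const card_ord -[X in _ * X]mulr_natl natrX.
rewrite [leLHS](_ : _ = (K * r) ^+ 2)//; field.
by rewrite gt_eqF.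
Qed.

(** For the distribution function [F] of a measure on [0, r], this compares the
    masses of [0, y/2] and [r - y/2, r], the two branches of the preimage of
    [0, y] under the tent map. *)
Definition folding r F y : R := F (y / 2) - (F r - F (r - y / 2)).

Section tent_invariant_increments.
Variables (r K : R) (F : R -> R).
Hypothesis r_gt0 : 0 < r.
Hypothesis Finv :
  forall y : R, 0 <= y <= r -> F y = F (y / 2) + (F r - F (r - y / 2)).
Hypothesis FK :
  forall x y : R, 0 <= x <= y -> y <= r -> `|F y - F x| <= K * (y - x).
Hypothesis F0 : F 0 = 0.

Let r0 : 0 <= r. Proof. exact: ltW. Qed.

(** The two preimages of the dyadic interval [k] of level [n] are the intervals
    [k] and [2 ^ n.+1 - k - 1] of level [n.+1]; the parallelogram law applies to
    their masses, whose sum is an increment of [F] and whose difference is an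
    increment of [folding r F]. *)
Lemma dyadic_energy_invariant n :
  dyadic_energy r F n.+1 =
  dyadic_energy r F n + dyadic_energy r (folding r F) n.
Proof.
rewrite /dyadic_energy expnS mul2n -addnn big_split_ord/=.
rewrite [X in _ + X](reindex_inj rev_ord_inj)/=.
rewrite -!mulrDr -!big_split/= [2 ^+ n.+1]exprSr -mulrA; congr (_ * _).
rewrite mulr_sumr; apply: eq_bigr => k _.
have kn := ltn_ord k.
have -> : dyadic_incr r F n.+1 (2 ^ n + (2 ^ n - k.+1))
  = F (r - dyadic r n k / 2) - F (r - dyadic r n k.+1 / 2).
  rewrite /dyadic_incr addnBA// addnn -mul2n -expnS -subSn ?subSS; last first.
    by rewrite expnS (leq_trans kn)// mul2n -addnn leq_addr.
  rewrite !dyadic_rev ?dyadic_half//; last 2 first.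
    by rewrite expnS (leq_trans kn)// mul2n -addnn leq_addr.
    by rewrite expnS (leq_trans (ltnW kn))// mul2n -addnn leq_addr.
rewrite /dyadic_incr !dyadic_half (@Finv (dyadic r n k)) ?dyadic_itv// 1?ltnW//.
rewrite (@Finv (dyadic r n k.+1)) ?dyadic_itv// /folding.
by ring.
Qed.

(** The energy of [F] grows at each level by the energy of its folding, which
    itself does not decrease; a positive value would make the former exceed any
    bound. *)
Lemma folding_energy_eq0 n :
  dyadic_energy r (folding r F) n = 0.
Proof.
apply/eqP; rewrite eq_le dyadic_energy_ge0 andbT.
rewrite leNgt; apply/negP; set v := dyadic_energy _ _ _ => v0.
have grow j : j%:R * v <= dyadic_energy r F (n + j).
  elim: j => [|j IH]; first by rewrite mul0r dyadic_energy_ge0.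
  rewrite addnS dyadic_energy_invariant -natr1 mulrDl mul1r lerD//.
  by apply: dyadic_energy_homo; rewrite leq_addr.
have := archi_boundP (divr_ge0 (sqr_ge0 (K * r)) (ltW v0)).
rewrite ltr_pdivrMr// ltNge => /negP; apply.
by apply: le_trans (grow _) _; exact: dyadic_energy_bounded.
Qed.

Lemma folding_dyadic_eq0 n k :
  (k <= 2 ^ n)%N -> folding r F (dyadic r n k) = 0.
Proof.
elim: k => [_|k IH kn].
  by rewrite dyadic0 /folding mul0r subr0 F0 subrr subr0.
have /eqP := folding_energy_eq0 n.
rewrite mulf_eq0 expf_eq0/= pnatr_eq0 andbF/=.
rewrite psumr_eq0 => [/allP/(_ (Ordinal kn))|? _]; last exact: sqr_ge0.
rewrite mem_index_enum => /(_ isT)/=.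
by rewrite sqrf_eq0 /dyadic_incr IH ?subr0 1?ltnW// => /eqP.
Qed.

(** Since the folding vanishes, passing from level [n] to level [n.+1] halves
    the value at points of the left branch and, by reflection, determines it on
    the right branch. *)
Lemma dyadic_value n k :
  (k <= 2 ^ n)%N -> F (dyadic r n k) = k%:R / 2 ^+ n * F r.
Proof.
elim: n k => [|n IH] k.
  rewrite expn0 /dyadic expr0 divr1.
  by case: k => [|[|//]]; rewrite ?mulr0 ?mul0r// mulr1 mul1r.
have half j : (j <= 2 ^ n)%N ->
    F (dyadic r n j / 2) = j%:R / 2 ^+ n.+1 * F r /\
    F (r - dyadic r n j / 2) = F r - j%:R / 2 ^+ n.+1 * F r.
  move=> jn; have := folding_dyadic_eq0 jn.
  have := Finv (dyadic_itv r0 jn); rewrite IH// /folding exprS invfM.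
  move=> /[swap] /eqP; rewrite subr_eq0 => /eqP e1 e2.
  have e : F (dyadic r n j / 2) = j%:R * (2^-1 / 2 ^+ n) * F r.
    by rewrite [RHS](_ : _ = (j%:R / 2 ^+ n * F r) / 2); [lra|ring].
  by split => //; lra.
have [kn _|kn kn1] := leqP k (2 ^ n).
  by rewrite dyadic_half (half _ kn).1.
have jn : (2 ^ n.+1 - k <= 2 ^ n)%N.
  by rewrite leq_subLR expnS mul2n -addnn leq_add2r ltnW.
rewrite -[in LHS](subKn kn1) dyadic_rev ?leq_subr// dyadic_half (half _ jn).2.
rewrite natrB// natrX mulrBl divff ?mulrBl; first by ring.
by rewrite expf_neq0// pnatr_eq0.
Qed.

(** Ergodicity of the tent map for Lipschitz distribution functions: dyadic
    points are dense and the error at scale [2 ^- n] is Lipschitz-small. *)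
Lemma dyadic_rigidity (x : R) : 0 <= x <= r -> F x = x / r * F r.
Proof.
move=> /andP[x0 xr]; apply/eqP; rewrite -subr_eq0 -normr_le0.
rewrite leNgt; apply/negP; set e := `|_| => e0.
have K0 : 0 <= K.
  have := @FK 0 r; rewrite !lexx r0/= => /(_ isT isT) /(le_trans (normr_ge0 _)).
  by rewrite subr0 pmulr_lge0.
have approx n : e <= (K * r + `|F r|) / 2 ^+ n.
  have p : (0 : R) < 2 ^+ n by rewrite exprn_gt0.
  have y0 : 0 <= x / r * 2 ^+ n by rewrite mulr_ge0 ?divr_ge0// ltW.
  (* [k] is the largest index with [dyadic r n k <= x]. *)
  pose k := Num.truncn (x / r * 2 ^+ n).
  have /andP[k1 k2] := truncn_itv y0; rewrite -/k in k1 k2.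
  have kn : (k <= 2 ^ n)%N.
    rewrite -(ler_nat R) natrX (le_trans k1)// ler_piMl ?(ltW p)//.
    by rewrite ler_pdivrMr// mul1r.
  have kx : dyadic r n k <= x.
    by rewrite /dyadic mulrA ler_pdivrMr// mulrC -ler_pdivlMr// mulrAC.
  have xk : x - dyadic r n k <= r / 2 ^+ n.
    rewrite /dyadic lerBlDr -mulrDr -[X in X + _]mul1r -mulrDl nat1r mulrA.
    by rewrite ler_pdivlMr// [leRHS]mulrC -ler_pdivrMr// mulrAC ltW.
  have /andP[dk0 _] := dyadic_itv r0 kn.
  rewrite /e; have -> : F x - x / r * F r = (F x - F (dyadic r n k))
      - (x / r - k%:R / 2 ^+ n) * F r.
    by rewrite (dyadic_value kn); ring.
  rewrite (le_trans (ler_normB _ _))// [leRHS]mulrDl lerD//.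
    apply: le_trans (FK _ _) _; rewrite ?dk0//.
    by rewrite -mulrA ler_wpM2l.
  rewrite normrM mulrC ler_wpM2l// ger0_norm.
    by rewrite lerBlDr -[X in X + _]mul1r -mulrDl nat1r ler_pdivlMr// ltW.
  by rewrite subr_ge0 ler_pdivrMr.
have := archi_boundP (divr_ge0 (addr_ge0 (mulr_ge0 K0 r0) (normr_ge0 (F r))) (ltW e0)).
set n := Num.bound _; rewrite ltr_pdivrMr// => h.
have := approx n; rewrite ler_pdivlMr ?exprn_gt0// leNgt => /negP; apply.
apply: lt_le_trans h _; rewrite mulrC ler_wpM2l// ?(ltW e0)//.
by rewrite -natrX ler_nat ltnW// ltn_expl.
Qed.

End tent_invariant_increments.

End dyadic_rigidity.

(** * Finite measures, densities and intervals *)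

Section measure_tools.
Local Open Scope ereal_scope.
Context d (T : measurableType d) (R : realType).

Lemma measure_setI_conull (m : {measure set T -> \bar R}) (A D : set T) :
  measurable A -> measurable D -> m (~` D) = 0 -> m A = m (A `&` D).
Proof.
move=> mA mD m0; rewrite (measureDI m mA mD) [X in X + _](_ : _ = 0) ?add0e//.
apply: subset_measure0 m0; [exact: measurableD|exact: measurableC|].
by move=> x [].
Qed.

Lemma lty_fin_num_fun_measure (m : {measure set T -> \bar R}) :
  m setT < +oo -> fin_num_fun m.
Proof.
move=> mT A mA; rewrite ge0_fin_numE//; apply: le_lt_trans mT.
by apply: le_measure; rewrite ?inE.
Qed.

(** Provides the finite-measure structure that the Radon-Nikodym theory
    expects. *)
Lemma pack_finite_measure (m : {measure set T -> \bar R}) : m setT < +oo ->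
  exists m' : {finite_measure set T -> \bar R}, forall A, m' A = m A.
Proof.
move=> mT; pose H0 := isMeasure.Build _ _ _ (m : set T -> \bar R) (measure0 m)
  (@measure_ge0 _ _ _ m) (@measure_semi_sigma_additive _ _ _ m).
pose m0 : {measure set T -> \bar R} := HB.pack (m : set T -> \bar R) H0.
pose H := @Measure_isFinite.Build _ _ _ m0 (lty_fin_num_fun_measure mT).
pose m1 : {finite_measure set T -> \bar R} := HB.pack (m : set T -> \bar R) H0 H.
by exists m1.
Qed.

(** Change of density.  The Radon-Nikodym derivative of [tau] agrees almost
    everywhere with [h], as both have the same integrals. *)
Lemma ge0_integral_density (mu : {sigma_finite_measure set T -> \bar R})
    (tau : {measure set T -> \bar R}) (h : T -> \bar R) :
  measurable_fun setT h -> (forall x, 0 <= h x) -> tau setT < +oo ->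
  (forall A, measurable A -> tau A = \int[mu]_(x in A) h x) ->
  forall E (f : T -> \bar R), measurable E -> measurable_fun setT f ->
  (forall x, 0 <= f x) ->
  \int[tau]_(x in E) f x = \int[mu]_(x in E) (f x * h x).
Proof.
move=> mh h0 tauT tauE E f mE mf f0.
have [tau' tau'E] := pack_finite_measure tauT.
transitivity (\int[tau']_(x in E) f x).
  by apply: eq_measure_integral => A mA _; exact/esym/tau'E.
have {}tauE A : measurable A -> tau' A = \int[mu]_(x in A) h x.
  by move=> mA; rewrite -tauE//; exact: tau'E.
have domtau : tau' `<< mu.
  apply/null_content_dominatesP => A mA muA.
  by rewrite [LHS]tauE//; apply: null_set_integral => //; exact: measurable_funTS.
rewrite -[LHS](Radon_Nikodym_SigmaFinite.change_of_variables domtau f0 mE); last first.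
  exact: measurable_funTS.
(* Equal integrals over all measurable sets identify the two derivatives. *)
have RN : ae_eq mu setT (Radon_Nikodym_SigmaFinite.f tau' mu) h.
  apply: integral_ae_eq => //.
    exact: Radon_Nikodym_SigmaFinite.f_integrable.
  move=> A _ mA.
  by rewrite -Radon_Nikodym_SigmaFinite.f_integral//= tauE.
have mRN : measurable_fun setT (Radon_Nikodym_SigmaFinite.f tau' mu).
  exact: measurable_int (Radon_Nikodym_SigmaFinite.f_integrable domtau).
apply: ae_eq_integral => //.
- by apply: measurable_funTS; exact: emeasurable_funM.
- by apply: measurable_funTS; exact: emeasurable_funM.
- by move: RN; apply: filterS => x /= /(_ Logic.I) -> _.
Qed.

(** A positive density can be cancelled: both [m1 A] and [m2 A] are the integral
    of [1 / g] against the common measure with density [g]. *)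
Lemma eq_density_measure (m1 m2 : {measure set T -> \bar R}) (g : T -> R) :
  measurable_fun setT g -> (forall x, 0 <= g x)%R ->
  m1 setT < +oo -> m2 setT < +oo ->
  \int[m1]_x (g x)%:E < +oo ->
  (forall A, measurable A ->
    \int[m1]_(x in A) (g x)%:E = \int[m2]_(x in A) (g x)%:E) ->
  forall A, measurable A -> A `<=` [set x | (0 < g x)%R] -> m1 A = m2 A.
Proof.
move=> mg g0 m1T m2T gT m12 A mA Ag.
have mG : measurable_fun setT (EFin \o g) by exact/measurable_EFinP.
pose tau0 A := \int[m1]_(x in A) (g x)%:E.
have t0 : tau0 set0 = 0 by rewrite /tau0 integral_set0.
have tp B : 0 <= tau0 B by apply: integral_ge0 => x _; rewrite lee_fin.
have ts : semi_sigma_additive tau0.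
  by apply: semi_sigma_additive_nng_induced => // x; rewrite lee_fin.
pose HM := isMeasure.Build _ _ _ tau0 t0 tp ts.
pose tau : {measure set T -> \bar R} := HB.pack tau0 HM.
(* The inverse is written as a real power to inherit its measurability. *)
pose f x : \bar R := ((g x) `^ (-1))%:E.
have mf : measurable_fun setT f.
  by apply/measurable_EFinP; exact: (measurableT_comp (measurable_powR _) mg).
have f0 x : 0 <= f x by rewrite lee_fin powR_ge0.
have key (m : {measure set T -> \bar R}) : m setT < +oo ->
    (forall B, measurable B -> tau0 B = \int[m]_(x in B) (g x)%:E) ->
    m A = \int[tau]_(x in A) f x.
  move=> mT mE.
  have [m' m'E] := pack_finite_measure mT.
  rewrite -m'E.
  rewrite (@ge0_integral_density m' tau (EFin \o g))//; last first.
    by move=> B mB; rewrite [LHS]mE//; apply: eq_measure_integral => C _ _; exact/esym/m'E.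
  rewrite -[LHS]mul1e -[LHS]integral_cst//; apply: eq_integral => x; rewrite inE => /Ag/= gx.
  by rewrite /f -EFinM powR_inv1 ?ltW// mulVf// gt_eqF.
by rewrite (key m1)// (key m2).
Qed.

End measure_tools.

Section measures_on_segment.
Local Open Scope ereal_scope.
Context (R : realType).
Implicit Types (m : {measure set R -> \bar R}).

Lemma eq_measure_segment m1 m2 (r : R) : (0 <= r)%R ->
  m1 (~` `[0%R, r]%classic) = 0 -> m2 (~` `[0%R, r]%classic) = 0 -> m1 `[0%R, r]%classic < +oo ->
  (forall x, (0 <= x <= r)%R -> m1 `[0%R, x]%classic = m2 `[0%R, x]%classic) ->
  forall A, measurable A -> m1 A = m2 A.
Proof.
move=> r0 m1r m2r m1f m12.
pose G := [set A : set R | exists x, A = `]-oo, x]%classic].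
have mItv x : measurable (`]-oo, x]%classic : set R) by exact: measurable_itv.
have mr : measurable (`[0%R, r]%classic : set R) by exact: measurable_itv.
have agree x : m1 `]-oo, x]%classic = m2 `]-oo, x]%classic.
  rewrite (measure_setI_conull (mItv x) mr m1r) (measure_setI_conull (mItv x) mr m2r).
  have [x0|x0] := ltP x 0%R.
    rewrite (_ : _ `&` _ = set0) ?measure0// -subset0 => y /= [].
    by rewrite !in_itv/= => yx /andP[y0 _]; lra.
  have [xr|rx] := leP x r.
    rewrite (_ : _ `&` _ = `[0%R, x]%classic) ?m12 ?x0//.
    apply/seteqP; split => y /=; rewrite !in_itv/=.
      by move=> [-> /andP[->]].
    by move=> /andP[-> yx]; split => //; lra.
  rewrite (_ : _ `&` _ = `[0%R, r]%classic) ?m12 ?r0 ?lexx//.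
  apply/seteqP; split => y /=; rewrite !in_itv/=; [by move=> []|move=> /andP[-> yr]].
  by split => //; lra.
(* The half-lines form a pi-system generating the Borel sets. *)
apply: (measure_unique G (fun n => `]-oo, n%:R]%classic)) => //.
- rewrite eqEsubset; split => A.
    apply: smallest_sub; first exact: smallest_sigma_algebra.
    move=> _ [[a b] _ <-] /=.
    rewrite (_ : `]a, b]%classic = `]-oo, b]%classic `\` `]-oo, a]%classic).
      apply: (@measurableD _ (g_sigma_algebraType G)).
        by apply: sub_sigma_algebra; exists b.
      by apply: sub_sigma_algebra; exists a.
    apply/seteqP; split => y /=; rewrite !in_itv/=.
      by move=> /andP[ay ->]; split => //; apply/negP; rewrite -ltNge.
    by move=> [-> /negP]; rewrite -ltNge => ->.
  apply: smallest_sub; first exact: sigma_algebra_measurable.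
  by move=> _ [x ->].
- move=> _ _ [x ->] [y ->]; exists (Num.min x y).
  by apply/seteqP; split => z /=; rewrite !in_itv/= le_min => /andP.
- by move=> n; exists n%:R.
- rewrite -subTset => x _; exists (Num.bound `|x|%R) => //=.
  rewrite in_itv/=.
  by rewrite (le_trans (ler_norm x))// ltW// archi_boundP.
- by move=> _ [x ->]; exact: agree.
- move=> n; rewrite (measure_setI_conull (mItv _) mr m1r); apply: le_lt_trans m1f.
  by apply: le_measure; rewrite ?inE//; apply: measurableI.
Qed.

(** The distribution function of [m] meets the hypotheses of
    [dyadic_rigidity]: the density bound excludes atoms, so the two branches of
    the preimage of [0, y] may be treated as disjoint. *)
Lemma tent_invariant_measure m (r K : R) : (0 < r)%R ->
  m setT < +oo ->
  (forall a b, (0 <= a <= b)%R -> (b <= r)%R ->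
    m `[a, b]%classic <= (K * (b - a))%:E) ->
  (forall B, measurable B -> m (tent r @^-1` B) = m B) ->
  forall x, (0 <= x <= r)%R ->
    m `[0%R, x]%classic = (x / r)%:E * m `[0%R, r]%classic.
Proof.
move=> r0 mT mK minv.
have mfin : fin_num_fun m := lty_fin_num_fun_measure mT.
pose F (x : R) : R := fine (m `[0%R, x]%classic).
have FE x : m `[0%R, x]%classic = (F x)%:E.
  by rewrite /F fineK// mfin//; exact: measurable_itv.
have point a : (0 <= a <= r)%R -> m [set a] = 0.
  move=> /andP[a0 ar]; apply/eqP; rewrite -measure_le0 -set_itv1.
  by rewrite (le_trans (mK _ _ _ _))// ?subrr ?mulr0// a0 lexx.
have Fincr x y : (0 <= x <= y)%R -> m `]x, y]%classic = (F y - F x)%:E.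
  move=> /andP[x0 xy]; rewrite EFinB -!FE.
  have -> : `[0%R, y]%classic = `[0%R, x]%classic `|` `]x, y]%classic :> set R.
    by rewrite -(@itv_bndbnd_setU _ _ _ (BRight x)) ?bnd_simp.
  rewrite measureU//=.
    by rewrite addeAC subee ?add0e// mfin//; exact: measurable_itv.
  rewrite -subset0 => z/= []; rewrite !in_itv/= => /andP[_ zx] /andP[xz _].
  by lra.
have FK (x y : R) : (0 <= x <= y)%R -> (y <= r)%R -> (`|F y - F x| <= K * (y - x))%R.
  move=> xy yr; have Fxy := Fincr _ _ xy.
  rewrite ger0_norm; last by rewrite -lee_fin -Fxy.
  rewrite -lee_fin -Fxy; apply: (le_trans _ (mK _ _ xy yr)).
  apply: le_measure; rewrite ?inE; [exact: measurable_itv|exact: measurable_itv|].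
  by apply: subset_itvr; rewrite bnd_simp.
have F0 : F 0%R = 0%R.
  by rewrite /F set_itv1 point// lexx ltW.
have Finv (y : R) : (0 <= y <= r)%R -> F y = (F (y / 2) + (F r - F (r - y / 2)))%R.
  move=> /andP[y0 yr]; apply: EFin_inj.
  rewrite EFinD -(Fincr (r - y / 2)%R); last by apply/andP; split; lra.
  rewrite -!FE -minv; last exact: measurable_itv.
  have -> : tent r @^-1` `[0%R, y]%classic =
      (`[0%R, (y / 2)%R]%classic `|` `](r - y / 2)%R, r]%classic)
      `|` [set (r - y / 2)%R].
    apply/seteqP; split => x /=; rewrite !in_itv/= /tent.
      case: (leP x (r - x)%R) => xx /andP[tx1 tx2].
        by left; left; apply/andP; split; lra.
      have [e|ne] := eqVneq x (r - y / 2)%R; first by right.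
      left; right; rewrite lt_neqAle eq_sym ne/=; apply/andP; split; lra.
    by case: (leP x (r - x)%R) => xx [[/andP[x1 x2]|/andP[x1 x2]]|x12];
      apply/andP; split; lra.
  rewrite measureU0//.
  - rewrite measureU//; try exact: measurable_itv.
    rewrite -subset0 => z/= []; rewrite !in_itv/= => /andP[_ zx] /andP[xz _].
    by lra.
  - by apply: measurableU; exact: measurable_itv.
  - by apply: point; apply/andP; split; lra.
move=> x xr; rewrite !FE -EFinM; congr EFin.
exact: (dyadic_rigidity r0 Finv FK F0 xr).
Qed.

End measures_on_segment.

(** * Coherence as a decomposition of the distribution *)

Section image_measure.
Context d d' (T1 : measurableType d) (T2 : measurableType d') (R : realType).
Variables (m : {measure set T1 -> \bar R}) (f : T1 -> T2).
Hypothesis mf : measurable_fun [set: T1] f.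

(** The push-forward bundled with its measure structure, which depends on the
    proof of measurability. *)
Definition image_measure : {measure set T2 -> \bar R}.
Proof. by refine (pushforward m f); exact: mf. Defined.

Lemma ge0_integral_image_measure D (g : T2 -> \bar R) :
  measurable D -> measurable_fun setT g -> (forall y, 0 <= g y)%E ->
  (\int[image_measure]_(y in D) g y = \int[m]_(x in f @^-1` D) g (f x))%E.
Proof.
move=> mD mg g0; rewrite -(ge0_integral_pushforward mf m mD)//.
exact: measurable_funTS.
Qed.

End image_measure.
Arguments image_measure {d d' T1 T2 R} m {f} mf.

Lemma preimage_measurable d d' (T1 : measurableType d) (T2 : measurableType d')
    (f : T1 -> T2) B :
  measurable_fun setT f -> measurable B -> measurable (f @^-1` B).
Proof. by move=> mf mB; rewrite -[X in measurable X]setTI; exact: mf. Qed.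

Section coherent_decomposition.
Local Open Scope ereal_scope.
Context (R : realType).

(** Here [mu A] stands for the probability that E holds and the vector lies in
    [A], and [nu A] for the complementary event.  The absolute values keep the
    integrands nonnegative on the whole plane; they change nothing on the unit
    square. *)
Definition coherent_decomposition (m mu nu : {measure set (R * R)%type -> \bar R}) :=
  [/\ forall A, measurable A -> m A = mu A + nu A,
      forall B, measurable B ->
        mu (fst @^-1` B) = \int[m]_(p in fst @^-1` B) `|p.1|%:E &
      forall B, measurable B ->
        mu (snd @^-1` B) = \int[m]_(p in snd @^-1` B) `|p.2|%:E].

(** The defining identity of a conditional probability, transported from the
    version [Y] to the almost surely equal variable [Z], whose own level sets
    need not lie in [G]. *)
Lemma is_cond_prob_integral d (T : measurableType d) (P : probability T R)
    E G (Z : T -> R) B : measurable E -> sub_sigma_field G ->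
  is_cond_prob P E G Z -> measurable_fun setT Z ->
  {ae P, forall w, (0 <= Z w)%R} -> measurable B ->
  P (E `&` Z @^-1` B) = \int[P]_(w in Z @^-1` B) `|Z w|%:E.
Proof.
move=> mE [_ sG] [Y [YG iY YE] ZY] mZ Z0 mB.
have mY : measurable_fun setT Y.
  by apply/measurable_EFinP; exact: measurable_int iY.
have [N [mN PN0 ZN]] : {ae P, forall w, Z w = Y w /\ (0 <= Z w)%R}.
  by apply: filterS2 ZY Z0 => w.
have {}ZN w : ~ N w -> Z w = Y w /\ (0 <= Z w)%R.
  by move=> nN; apply: contrapT => h; apply/nN/ZN.
have mZB := preimage_measurable mZ mB.
have mYB := preimage_measurable mY mB.
have ZYB : Z @^-1` B `&` ~` N = Y @^-1` B `&` ~` N.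
  apply/seteqP; split=> w/= [wB wN]; split=> //; have [ZYw _] := ZN _ wN.
    by rewrite -ZYw.
  by rewrite ZYw.
have mNC := measurableC mN.
have PN : P (~` ~` N) = 0 by rewrite setCK.
rewrite (measure_setI_conull (measurableI _ _ mE mZB) mNC PN).
rewrite -setIA ZYB setIA.
rewrite -(measure_setI_conull (measurableI _ _ mE mYB) mNC PN).
transitivity (\int[P]_(w in Y @^-1` B) (Y w)%:E); first by apply/esym/YE/YG.
rewrite (negligible_integral mN) //; last exact: integrableS iY.
rewrite [RHS](ge0_negligible_integral mN)//; last first.
  by apply: measurable_funTS; apply/measurable_EFinP; exact: measurableT_comp.
rewrite !setDE ZYB; apply: eq_integral => w; rewrite inE => -[_ /ZN[<- Zw]].
by rewrite ger0_norm.
Qed.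

Lemma coherent_decompose (m : {measure set (R * R)%type -> \bar R}) :
  coherent m -> exists mu nu, coherent_decomposition m mu nu.
Proof.
move=> [_ msq [d [T [P [X [[E [G1 [G2 [mE sG1 sG2 E1 E2]]]] mX]]]]]].
have mXf : measurable_fun setT X by exact: measurable_funPT.
have mX1 : measurable_fun setT (fun w => (X w).1).
  exact: (measurableT_comp measurable_fst).
have mX2 : measurable_fun setT (fun w => (X w).2).
  exact: (measurableT_comp measurable_snd).
have msqr : measurable (@unit_square R) by apply: measurableX; exact: measurable_itv.
have Xsq : {ae P, forall w, unit_square (X w)}.
  exists (X @^-1` ~` (@unit_square R)); split => //.
    by apply: preimage_measurable => //; exact: measurableC.
  rewrite -preimage_setC probability_setC; last exact: preimage_measurable.
  rewrite (_ : P _ = 1) ?subee// -msq; exact/esym/mX.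
exists (image_measure (mrestr P mE) mXf).
exists (image_measure (mrestr P (measurableC mE)) mXf).
have mint (f : R * R -> \bar R) D : measurable D ->
    measurable_fun setT f -> (forall p, 0 <= f p) ->
    \int[m]_(p in D) f p = \int[P]_(w in X @^-1` D) f (X w).
  move=> mD mf f0; rewrite -(ge0_integral_image_measure P mXf mD mf f0).
  by apply: eq_measure_integral => A mA _; exact: mX.
split.
- move=> A mA; have mXA := preimage_measurable mXf mA.
  rewrite mX// -[RHS]/(P (X @^-1` A `&` E) + P (X @^-1` A `&` ~` E)).
  rewrite -[LHS]/(P (X @^-1` A)) (measureDI P mXA mE) setDE; exact: addeC.
- move=> B mB; rewrite -[LHS]/(P (_ `&` E)) setIC.
  rewrite mint//; last 2 first.
    exact: preimage_measurable.
    by apply/measurable_EFinP; apply: measurableT_comp => //; exact: measurable_fst.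
  apply: (is_cond_prob_integral mE sG1 E1) => //.
  by apply: filterS Xsq => w [/=]; rewrite in_itv/= => /andP[].
- move=> B mB; rewrite -[LHS]/(P (_ `&` E)) setIC.
  rewrite mint//; last 2 first.
    exact: preimage_measurable.
    by apply/measurable_EFinP; apply: measurableT_comp => //; exact: measurable_snd.
  apply: (is_cond_prob_integral mE sG2 E2) => //.
  by apply: filterS Xsq => w [/= _]; rewrite in_itv/= => /andP[].
Qed.

End coherent_decomposition.

Section coherent_of_decomposition.
Local Open Scope ereal_scope.
Context (R : realType).

Lemma pack_probability d (T : measurableType d) (m : {measure set T -> \bar R}) :
  m setT = 1 -> exists P : probability T R, forall A, P A = m A.
Proof.
move=> mT; pose H0 := isMeasure.Build _ _ _ (m : set T -> \bar R) (measure0 m)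
  (@measure_ge0 _ _ _ m) (@measure_semi_sigma_additive _ _ _ m).
pose m0 : {measure set T -> \bar R} := HB.pack (m : set T -> \bar R) H0.
pose H := @Measure_isProbability.Build _ _ _ m0 mT.
pose P : probability T R := HB.pack (m : set T -> \bar R) H0 H.
by exists P.
Qed.

(** The vector is realised on the plane times [bool], with law [mu] on the copy
    marked [true] and [nu] on the other; E is the event that the mark is [true]
    and each sigma-field is generated by one coordinate of the point. *)
Lemma coherent_of_decomposition (m mu nu : {measure set (R * R)%type -> \bar R}) :
  m setT = 1 -> m (@unit_square R) = 1 -> coherent_decomposition m mu nu ->
  coherent m.
Proof.
move=> mT msq [mE mu1 mu2]; split => //.
pose T : measurableType _ := ((R * R) * bool)%type.
have mtag (b : bool) : measurable_fun setT (fun p : R * R => (p, b) : T).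
  by apply: measurable_fun_pair => //; exact: measurable_cst.
have [P PE] : exists P : probability T R, forall A : set T,
    P A = mu [set p | A (p, true)] + nu [set p | A (p, false)].
  pose P0 := measure_add (image_measure mu (mtag true)) (image_measure nu (mtag false)).
  have P0E A : P0 A = mu [set p | A (p, true)] + nu [set p | A (p, false)].
    exact: measure_addE.
  have [|P PE] := @pack_probability _ T P0; last by exists P => A; rewrite PE.
  by rewrite [LHS]P0E -mT mE.
have mfst : measurable_fun setT (fst : T -> R * R) by exact: measurable_fst.
have PmE D : measurable D -> P (fst @^-1` D) = m D.
  by move=> mD; rewrite [LHS]PE mE.
have Pint (f : R * R -> \bar R) D : measurable D ->
    measurable_fun setT f -> (forall p, 0 <= f p) ->
    \int[P]_(w in fst @^-1` D) f w.1 = \int[m]_(p in D) f p.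
  move=> mD mf f0; rewrite -(ge0_integral_image_measure P mfst mD mf f0).
  by apply: eq_measure_integral => A mA _; exact: PmE.
have msqr : measurable (@unit_square R) by apply: measurableX; exact: measurable_itv.
have Psq : {ae P, forall w : T, unit_square w.1}.
  exists (fst @^-1` ~` (@unit_square R)); split => //.
    by apply: preimage_measurable => //; exact: measurableC.
  rewrite -preimage_setC probability_setC; last exact: preimage_measurable.
  by rewrite (_ : P _ = 1) ?subee// -msq; exact: PmE.
pose E : set T := snd @^-1` [set true].
have mEs : measurable E.
  by apply: preimage_measurable => //; exact: measurable_snd.
pose G (c : R * R -> R) := preimage_set_system setT (fun w : T => c w.1) measurable.
have condP (c : R * R -> R) : measurable_fun setT c ->
    (forall p, unit_square p -> (0 <= c p)%R) ->
    (forall B, measurable B -> mu (c @^-1` B) = \int[m]_(p in c @^-1` B) `|c p|%:E) ->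
    sub_sigma_field (G c) /\ is_cond_prob P E (G c) (fun w : T => c w.1).
  move=> mc c0 muc.
  have mcT : measurable_fun setT (fun w : T => c w.1) by exact: measurableT_comp.
  have mabs : measurable_fun setT (fun p => `|c p|%:E).
    by apply/measurable_EFinP; exact: measurableT_comp.
  split.
    split; first by apply: sigma_algebra_preimage; exact: sigma_algebra_measurable.
    by move=> _ [B mB <-]; rewrite setTI; exact: preimage_measurable.
  exists (fun w : T => c w.1) => //; last exact: aeW.
  split.
  - by move=> B mB; exists B => //; rewrite setTI.
  - apply/integrableP; split; first exact/measurable_EFinP.
    rewrite (_ : integral _ _ _ = \int[m]_p `|c p|%:E).
      rewrite -[X in \int[m]_(_ in X) _](preimage_setT c) -muc//.
      apply: (@le_lt_trans _ _ (m setT)); last by rewrite mT ltry.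
      by rewrite mE// leeDl.
    by rewrite -[RHS]Pint// preimage_setT.
  - move=> _ [B mB <-]; rewrite setTI.
    transitivity (\int[P]_(w in fst @^-1` (c @^-1` B)) `|c w.1|%:E).
      apply: ae_eq_integral => //.
      + exact: preimage_measurable.
      + by apply: measurable_funTS; apply/measurable_EFinP.
      + by apply: measurable_funTS; exact: (measurableT_comp mabs mfst).
      + by apply: filterS Psq => w /c0 cw _; rewrite ger0_norm.
    have mcB : measurable (c @^-1` B) by exact: preimage_measurable.
    transitivity (\int[m]_(p in c @^-1` B) `|c p|%:E).
      exact: (Pint (fun p => `|c p|%:E)).
    rewrite -muc// [RHS]PE [X in nu X](_ : _ = set0); last first.
      by rewrite -subset0 => p [].
    rewrite measure0 adde0; congr (mu _).
    by apply/seteqP; split => [p ?|p []].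
have [sG1 E1] := condP fst measurable_fst
  (fun p sp => ltac:(by case: sp; rewrite /= in_itv/= => /andP[])) mu1.
have [sG2 E2] := condP snd measurable_snd
  (fun p sp => ltac:(by case: sp => _; rewrite /= in_itv/= => /andP[])) mu2.
pose HX := isMeasurableFun.Build _ _ _ _ (fst : T -> R * R) mfst.
pose X : {RV P >-> (R * R)%type} := HB.pack (fst : T -> R * R) HX.
exists _, T, P, X; split; last by move=> A mA; rewrite -PmE.
by exists E, (G fst), (G snd); split.
Qed.

End coherent_of_decomposition.

(** * Measures carried by a graph *)

Section graph_measures.
Local Open Scope ereal_scope.
Context (R : realType).
Local Notation leb := (@lebesgue_measure R).
Implicit Types (m : {measure set (R * R)%type -> \bar R}) (g f : R -> R).

Definition graph_upto g (x : R) : set (R * R) := [set (s, g s) | s in `[0%R, x]].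

Lemma graph_uptoE g (x : R) :
  graph_upto g x = fst @^-1` `[0%R, x] `&` [set p | p.2 = g p.1].
Proof.
by apply/seteqP; split => [_ [s sx <-]//|[s y] [/= sx ->]]; exists s.
Qed.

Lemma measurable_graph g : measurable_fun setT g ->
  measurable [set p : R * R | p.2 = g p.1].
Proof.
move=> mg.
have mh : measurable_fun setT (fun p : R * R => p.2 - g p.1)%R.
  apply: measurable_funB; first exact: measurable_snd.
  by apply: measurableT_comp => //; exact: measurable_fst.
rewrite (_ : [set p | _] = (fun p : R * R => p.2 - g p.1)%R @^-1` [set 0%R]).
  exact: preimage_measurable.
apply/seteqP; split => p/=; first by move=> ->; rewrite subrr.
by move=> /eqP; rewrite subr_eq0 => /eqP.
Qed.

Lemma measurable_graph_upto g (x : R) : measurable_fun setT g ->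
  measurable (graph_upto g x).
Proof.
move=> mg; rewrite graph_uptoE; apply: measurableI; last exact: measurable_graph.
by apply: preimage_measurable; [exact: measurable_fst|exact: measurable_itv].
Qed.

Lemma measurable_section g (A : set (R * R)) : measurable_fun setT g ->
  measurable A -> measurable [set x | A (x, g x)].
Proof.
move=> mg mA.
have mpair : measurable_fun setT (fun x : R => (x, g x)) by exact: measurable_fun_pair.
exact: (preimage_measurable mpair mA).
Qed.

(** A measure carried by a graph is determined by its first projection. *)
Lemma graph_measure_section g (r : R) m : measurable_fun setT g ->
  m (~` graph_upto g r) = 0 ->
  forall A, measurable A -> m A = m (fst @^-1` [set x | A (x, g x)]).
Proof.
move=> mg m0 A mA.
have mG : measurable (graph_upto g r) := measurable_graph_upto _ mg.
have mS : measurable (fst @^-1` [set x | A (x, g x)] : set (R * R)).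
  by apply: preimage_measurable; [exact: measurable_fst|exact: measurable_section].
rewrite (measure_setI_conull mA mG m0) (measure_setI_conull mS mG m0).
congr (m _); apply/seteqP; split => p /=.
  by move=> [Ap [s sr e]]; move: Ap; rewrite -e => Ap; split => //; exists s.
by move=> [Ap [s sr e]]; move: Ap; rewrite -e => Ap; split => //; exists s.
Qed.

Lemma graph_measure_snd g (r : R) m : measurable_fun setT g ->
  m (~` graph_upto g r) = 0 ->
  forall B, measurable B -> m (snd @^-1` B) = m (fst @^-1` (g @^-1` B)).
Proof.
move=> mg m0 B mB; apply: (graph_measure_section mg m0).
by apply: preimage_measurable => //; exact: measurable_snd.
Qed.

(** The density [c * f] on [0, r], extended by zero to the line so that
    integrals over arbitrary Borel sets make sense. *)
Definition restricted_density (c : R) f (r x : R) : R :=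
  if x \in `[0%R, r] then (c * f x)%R else 0%R.

Lemma restricted_density_ge0 (c : R) f (r x : R) : (0 <= c)%R ->
  (forall x, x \in `[0%R, r] -> (0 <= f x)%R) ->
  (0 <= restricted_density c f r x)%R.
Proof.
move=> c0 f0; rewrite /restricted_density; case: ifPn => // xr.
by rewrite mulr_ge0// f0.
Qed.

Lemma measurable_restricted_density (c : R) f (r : R) :
  measurable_fun `[0%R, r]%classic f -> measurable_fun setT (restricted_density c f r).
Proof.
move=> mf; have -> : restricted_density c f r =
    (fun x => (c * f x)%R) \_ `[0%R, r]%classic.
  by apply/funext => x; rewrite /restricted_density patchE mem_setE.
apply/(measurable_restrictT _ _).1; first exact: measurable_itv.
exact: measurable_funM.
Qed.

(** The masses prescribed on initial arcs of the graph fix the distribution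
    function of the first projection, hence the projection itself. *)
Lemma graph_measure_density g f (c r : R) m : (0 <= r)%R -> (0 <= c)%R ->
  measurable_fun setT g -> leb.-integrable `[0%R, r] (EFin \o f) ->
  (forall x, x \in `[0%R, r] -> (0 <= f x)%R) ->
  m (~` graph_upto g r) = 0 ->
  (forall x, (0 <= x <= r)%R ->
    m (graph_upto g x) = (c * \int[leb]_(s in `[0%R, x]) f s)%:E) ->
  forall A, measurable A ->
    m (fst @^-1` A) = \int[leb]_(x in A) (restricted_density c f r x)%:E.
Proof.
move=> r0 c0 mg intf f0 m0 mx A mA.
set h := restricted_density c f r.
have h0 x : (0 <= h x)%R by exact: restricted_density_ge0.
have mh : measurable_fun setT (EFin \o h).
  apply/measurable_EFinP; apply: measurable_restricted_density.
  by apply/measurable_EFinP; exact: measurable_int intf.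
pose lam (A : set R) : \bar R := \int[leb]_(x in A) (h x)%:E.
have lam0 : lam set0 = 0 by rewrite /lam integral_set0.
have lam_ge0 B : 0 <= lam B by apply: integral_ge0 => x _; rewrite lee_fin.
have lamU : semi_sigma_additive lam.
  exact: (@semi_sigma_additive_nng_induced _ (measurableTypeR R) R leb).
pose HM := isMeasure.Build _ _ _ lam lam0 lam_ge0 lamU.
pose L : {measure set R -> \bar R} := HB.pack lam HM.
have mgr x : measurable (graph_upto g x) := measurable_graph_upto _ mg.
have mfst B : measurable B -> measurable (fst @^-1` B : set (R * R)).
  by move=> mB; apply: preimage_measurable => //; exact: measurable_fst.
have mitv x : measurable (`[0%R, x]%classic : set R) by exact: measurable_itv.
pose M1 := image_measure m (@measurable_fst _ _ R R).
have M1x x : (0 <= x <= r)%R -> M1 `[0%R, x]%classic = m (graph_upto g x).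
  move=> /andP[x0 xr].
  rewrite [LHS](measure_setI_conull (mfst _ (mitv x)) (mgr r) m0).
  congr (m _); rewrite !graph_uptoE setIA -preimage_setI; congr (fst @^-1` _ `&` _).
  by apply/setIidl/subset_itvl; rewrite bnd_simp.
have Lx x : (0 <= x <= r)%R ->
    L `[0%R, x]%classic = (c * \int[leb]_(s in `[0%R, x]) f s)%:E.
  move=> /andP[x0 xr].
  have sub : `[0%R, x]%classic `<=` `[0%R, r]%classic.
    by apply: subset_itvl; rewrite bnd_simp.
  have ix : leb.-integrable `[0%R, x] (EFin \o f) by exact: integrableS intf.
  rewrite EFinM fineK; last exact: integrable_fin_num.
  rewrite -integralZl//.
  by apply: eq_integral => y /[!inE] /sub yr; rewrite /h /restricted_density yr -EFinM.
apply: (@eq_measure_segment _ M1 L r) => //.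
- apply: (subset_measure0 _ _ _ m0).
  + by apply: mfst; apply: measurableC; exact: mitv.
  + by apply: measurableC; exact: (mgr r).
  + by move=> p /= pr; rewrite graph_uptoE => -[].
- apply: integral0_eq => x /= xr; rewrite /h /restricted_density ifF//.
  by apply/negbTE/negP.
- by rewrite (M1x r) ?lexx ?r0// (mx r) ?lexx ?r0// ltry.
- by move=> x xr; rewrite M1x// mx// Lx.
Qed.

End graph_measures.

(** * The measure m_r is coherent *)

Section the_extreme_measure.
Local Open Scope ereal_scope.
Context (R : realType) (r : R).
Hypothesis r01 : (0 < r < 1)%R.
Local Notation leb := (@lebesgue_measure R).
Local Notation odds := (fun s : R => s / (1 - s))%R.

Let r0 : (0 < r)%R. Proof. by case/andP: r01. Qed.
Let r1 : (r < 1)%R. Proof. by case/andP: r01. Qed.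

Lemma odds_ge0 x : x \in `[0%R, r] -> (0 <= odds x)%R.
Proof.
rewrite in_itv/= => /andP[x0 xr].
by rewrite divr_ge0// subr_ge0; exact: le_trans xr (ltW r1).
Qed.

Lemma odds_integrable : leb.-integrable `[0%R, r] (EFin \o odds).
Proof.
apply: continuous_compact_integrable; first exact: segment_compact.
apply: continuous_in_subspaceT => x; rewrite inE/= in_itv/= => /andP[x0 xr].
have x1 : (1 - x != 0)%R by rewrite subr_eq0 gt_eqF// (le_lt_trans xr).
apply: cvgM; first exact: cvg_id.
by apply: cvgV => //; apply: cvgB; [exact: cvg_cst|exact: cvg_id].
Qed.

Lemma cst1_integrable : leb.-integrable `[0%R, r] (EFin \o cst 1%R).
Proof.
apply: continuous_compact_integrable; first exact: segment_compact.
by apply: continuous_subspaceT => x; exact: cvg_cst.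
Qed.

Lemma measurable_tent : measurable_fun setT (tent r).
Proof.
apply: measurable_funM => //; apply: measurable_minr => //.
exact: measurable_funB.
Qed.

Lemma lebesgue_segment (a b : R) : (a <= b)%R ->
  leb `[a, b]%classic = (b - a)%:E.
Proof.
move=> ab; rewrite lebesgue_measure_itv/= lte_fin.
by case: ltP => // ba; rewrite (@le_anti _ _ a b) ?ab// subrr.
Qed.

Lemma norm_constE :
  norm_const r = (\int[leb]_(s in `[0%R, r]) odds s + r)%R.
Proof.
rewrite /norm_const RintegralD//; [|exact: odds_integrable|exact: cst1_integrable].
congr (_ + _)%R.
by rewrite Rintegral_cst//= lebesgue_segment ?ltW//= mul1r subr0.
Qed.

Lemma norm_const_gt0 : (0 < norm_const r)%R.
Proof.
by rewrite norm_constE ltr_wpDl//; apply: Rintegral_ge0 => x; exact: odds_ge0.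
Qed.

Let c := (norm_const r)^-1%R.
Let c0 : (0 <= c)%R. Proof. by rewrite invr_ge0 ltW// norm_const_gt0. Qed.

Variables (mu nu : {measure set (R * R)%type -> \bar R}).
Hypotheses (hmu : is_mu r mu) (hnu : is_nu r nu).
Let m : {measure set (R * R)%type -> \bar R} := measure_add mu nu.

Lemma mu_fst A : measurable A ->
  mu (fst @^-1` A) = \int[leb]_(x in A) (restricted_density c odds r x)%:E.
Proof.
case: hmu => mu0 muE; apply: (graph_measure_density (ltW r0) c0 _ odds_integrable odds_ge0 mu0 muE).
exact: measurable_id.
Qed.

Lemma nu_fst A : measurable A ->
  nu (fst @^-1` A) = \int[leb]_(x in A) (restricted_density c (cst 1%R) r x)%:E.
Proof.
case: hnu => nu0 nuE.
by apply: (graph_measure_density (ltW r0) c0 measurable_tent cst1_integrable _ nu0 nuE).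
Qed.

Let mD : measurable (@diag_upto R r).
Proof. exact: (@measurable_graph_upto R id r (@measurable_id _ _ _)). Qed.

Let mG : measurable (@tent_graph_upto R r r).
Proof. exact: (@measurable_graph_upto R (tent r) r measurable_tent). Qed.

Let mrd1 : measurable_fun setT (restricted_density c odds r).
Proof.
apply: measurable_restricted_density; apply/measurable_EFinP.
exact: measurable_int odds_integrable.
Qed.

Let mrd2 : measurable_fun setT (restricted_density c (cst 1%R) r).
Proof. by apply: measurable_restricted_density; exact: measurable_cst. Qed.

Let rd1_ge0 x : (0 <= restricted_density c odds r x)%R.
Proof. by apply: restricted_density_ge0 => //; exact: odds_ge0. Qed.

Let rd2_ge0 x : (0 <= restricted_density c (cst 1%R) r x)%R.
Proof. exact: restricted_density_ge0. Qed.

Lemma nu_fst_segment a b : (0 <= a <= b)%R -> (b <= r)%R ->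
  nu (fst @^-1` `[a, b]) = (c * (b - a))%:E.
Proof.
move=> /andP[a0 ab] br; rewrite nu_fst; last exact: measurable_itv.
rewrite (eq_integral (cst c%:E)).
  by rewrite integral_cst//= lebesgue_segment.
move=> x; rewrite inE/= in_itv/= => /andP[ax xb].
by rewrite /restricted_density in_itv/= (le_trans a0 ax) (le_trans xb br) mulr1.
Qed.

Lemma mr_fst A : measurable A ->
  m (fst @^-1` A) = \int[leb]_(x in A)
    (restricted_density c odds r x + restricted_density c (cst 1%R) r x)%:E.
Proof.
move=> mA; rewrite [LHS]measure_addE mu_fst// nu_fst//.
rewrite -ge0_integralD//.
- by move=> x _; rewrite lee_fin.
- by apply: measurable_funTS; exact/measurable_EFinP.
- by move=> x _; rewrite lee_fin.
- by apply: measurable_funTS; exact/measurable_EFinP.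
Qed.

Lemma mr_setT : m setT = 1.
Proof.
have E : m setT = mu (diag_upto r) + nu (tent_graph_upto r r).
  rewrite [LHS]measure_addE; case: hmu => mu0 _; case: hnu => nu0 _.
  rewrite (measure_setI_conull measurableT mD mu0).
  by rewrite (measure_setI_conull measurableT mG nu0) !setTI.
case: hmu => _ muE; case: hnu => _ nuE.
have rr : (0 <= r <= r)%R by rewrite (ltW r0) lexx.
rewrite E (muE r rr) (nuE r rr).
rewrite -EFinD -mulrDr Rintegral_cst//= lebesgue_segment ?(ltW r0)//= mul1r subr0.
by rewrite -norm_constE mulVf// gt_eqF// norm_const_gt0.
Qed.

(** The first marginal has density [c / (1 - x)], bounded by [c / (1 - r)] on
    [0, r]. *)
Lemma mr_fst_segment a b : (0 <= a <= b)%R -> (b <= r)%R ->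
  m (fst @^-1` `[a, b]) <= (c / (1 - r) * (b - a))%:E.
Proof.
move=> /andP[a0 ab] br; rewrite mr_fst; last exact: measurable_itv.
rewrite EFinM -lebesgue_segment// -integral_cst//.
apply: ge0_le_integral => //.
- by move=> x _; rewrite lee_fin addr_ge0.
- by apply: measurable_funTS; apply/measurable_EFinP; exact: measurable_funD.
move=> x /=; rewrite in_itv/= => /andP[ax xb].
have x0 := le_trans a0 ax; have xr := le_trans xb br.
rewrite lee_fin /restricted_density in_itv/= x0 xr/= mulr1.
have x1 : (0 < 1 - x)%R by rewrite subr_gt0 (le_lt_trans xr).
have -> : (c * (x / (1 - x)) + c = c / (1 - x))%R.
  by field; rewrite gt_eqF.
by rewrite ler_wpM2l// lef_pV2 ?posrE ?subr_gt0 ?(le_lt_trans xr)// lerD2l lerN2.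
Qed.

(** Writing [h = x / (1 - x)], the density of the first marginal of [mu + nu] is
    proportional to [h + 1], and [x * (h + 1) = h]. *)
Lemma mu_fst_integral B : measurable B ->
  mu (fst @^-1` B) = \int[m]_(p in fst @^-1` B) `|p.1|%:E.
Proof.
move=> mB.
have mabs : measurable_fun setT (fun x : measurableTypeR R => `|x : R|%:E).
  by apply/measurable_EFinP; exact: normr_measurable.
have mfstR : measurable_fun setT (fst : R * R -> measurableTypeR R).
  exact: (@measurable_fst _ _ R R).
pose M := image_measure m mfstR.
transitivity (\int[M]_(x in B) `|x|%:E); last first.
  by rewrite (ge0_integral_image_measure m mfstR mB mabs).
rewrite (@ge0_integral_density _ _ _ leb M (fun x =>
  (restricted_density c odds r x + restricted_density c (cst 1%R) r x)%:E))//.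
- rewrite mu_fst//; apply: eq_integral => x _; rewrite -EFinM; congr EFin.
  rewrite /restricted_density in_itv/=; case: ifPn => [/andP[x0 xr]|_].
    rewrite ger0_norm//; field.
    by rewrite gt_eqF// subr_gt0 (le_lt_trans xr).
  by rewrite addr0 mulr0.
- by apply/measurable_EFinP; exact: measurable_funD.
- by move=> x; rewrite lee_fin addr_ge0.
- by rewrite [X in X < _]mr_setT ltry.
- by move=> A mA; exact: mr_fst.
Qed.

(** The tent map preserves the uniform law: the preimage of [0, x] consists of
    two segments of length [x / 2]. *)
Lemma nu_fst_tent B : measurable B ->
  nu (fst @^-1` (tent r @^-1` B)) = nu (fst @^-1` B).
Proof.
move=> mB.
pose L := image_measure nu (@measurable_fst _ _ R R).
have L0 : L (~` `[0%R, r]%classic) = 0.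
  case: hnu => nu0 _; apply: subset_measure0 nu0.
  - by apply: preimage_measurable; [exact: measurable_fst|exact: measurableC].
  - exact: measurableC.
  - by move=> p /= pr [s sr e]; apply: pr; rewrite -e.
have Lseg a b : (0 <= a <= b)%R -> (b <= r)%R -> L `[a, b]%classic = (c * (b - a))%:E.
  exact: nu_fst_segment.
apply: (@eq_measure_segment _ (image_measure L measurable_tent) L r) => //.
- exact: ltW.
- apply: subset_measure0 L0.
  + by apply: preimage_measurable; [exact: measurable_tent|exact: measurableC].
  + exact: measurableC.
  + move=> x /= tx xr; apply: tx; move: xr; rewrite !in_itv/= /tent => /andP[x0 xr].
    by case: (leP x (r - x)%R) => xx; apply/andP; split; lra.
- apply: (@le_lt_trans _ _ (m setT)); last by rewrite mr_setT ltry.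
  apply: (@le_trans _ _ (nu setT)).
    suff : nu (fst @^-1` (tent r @^-1` `[0%R, r])) <= nu setT by [].
    apply: le_measure; rewrite ?inE//.
    apply: preimage_measurable; first exact: measurable_fst.
    by apply: preimage_measurable; [exact: measurable_tent|exact: measurable_itv].
  by rewrite [leRHS]measure_addE leeDr.
- move=> x /andP[x0 xr]; rewrite [RHS]Lseg ?x0 ?lexx//.
  have -> : (c * (x - 0))%:E = L `[0%R, (x / 2)%R]%classic + L `[(r - x / 2)%R, r]%classic.
    have h1 : (0 <= (0 : R) <= x / 2)%R by rewrite lexx divr_ge0.
    have h2 : (0 <= r - x / 2 <= r)%R by apply/andP; split; lra.
    rewrite (Lseg _ _ h1) ?(Lseg _ _ h2)//; last by lra.
    by rewrite -EFinD; congr EFin; field.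
  have point : L [set (r - x / 2)%R] = 0.
    have h : (0 <= r - x / 2 <= r - x / 2)%R by apply/andP; split; lra.
    by rewrite -set_itv1 (Lseg _ _ h) ?subrr ?mulr0//; lra.
  have mset (a : R) : measurable [set a] by exact: measurable_set1.
  have split_cl : `[(r - x / 2)%R, r]%classic = `](r - x / 2)%R, r]%classic `|` [set (r - x / 2)%R].
    rewrite setUC setU1itv// bnd_simp; lra.
  rewrite split_cl measureU0//=.
  rewrite [LHS](_ : _ = L ((`[0%R, (x / 2)%R]%classic `|` `](r - x / 2)%R, r]%classic)
      `|` [set (r - x / 2)%R])); last first.
    congr (L _); apply/seteqP; split => y /=; rewrite !in_itv/= /tent.
      case: (leP y (r - y)%R) => yy /andP[tx1 tx2].
        by left; left; apply/andP; split; lra.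
      have [e|ne] := eqVneq y (r - x / 2)%R; first by right.
      left; right; rewrite lt_neqAle eq_sym ne/=; apply/andP; split; lra.
    by case: (leP y (r - y)%R) => yy [[/andP[y1 y2]|/andP[y1 y2]]|y12];
      apply/andP; split; lra.
  rewrite measureU0//.
    apply: measureU => //.
    rewrite -subset0 => z/= []; rewrite !in_itv/= => /andP[_ zx] /andP[xz _].
    by have := lt_le_trans xz zx; rewrite ltrBlDr -splitr ltNge xr.
  exact: measurableU.
Qed.

(** On the diagonal both projections agree, and on the graph they differ by the
    tent map, which preserves the projection of [nu]. *)
Lemma mr_marginals B : measurable B -> m (snd @^-1` B) = m (fst @^-1` B).
Proof.
move=> mB; rewrite [LHS]measure_addE [RHS]measure_addE.
case: hmu => mu0 _; case: hnu => nu0 _.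
rewrite (graph_measure_snd (@measurable_id _ _ _) mu0)//.
by rewrite (graph_measure_snd measurable_tent nu0)// nu_fst_tent.
Qed.

Lemma mr_decomposition : coherent_decomposition m mu nu.
Proof.
split; first by move=> A _; exact: measure_addE.
  exact: mu_fst_integral.
move=> B mB; case: hmu => mu0 _.
rewrite (graph_measure_snd (@measurable_id _ _ _) mu0)// mu_fst_integral//.
have mabs : measurable_fun setT (fun x : R => `|x|%:E).
  by apply/measurable_EFinP; exact: normr_measurable.
rewrite -(ge0_integral_image_measure m measurable_fst mB mabs)//.
rewrite -(ge0_integral_image_measure m measurable_snd mB mabs)//.
by apply: eq_measure_integral => A mA _; exact/esym/mr_marginals.
Qed.

Lemma mr_unit_square : m (@unit_square R) = 1.
Proof.
have msqr : measurable (@unit_square R) by apply: measurableX; exact: measurable_itv.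
rewrite -mr_setT [LHS]measure_addE [RHS]measure_addE.
case: hmu => mu0 _; case: hnu => nu0 _.
rewrite (measure_setI_conull msqr mD mu0) (measure_setI_conull msqr mG nu0).
rewrite (measure_setI_conull measurableT mD mu0) (measure_setI_conull measurableT mG nu0).
have hr1 : (r < 1)%R by exact: r1.
rewrite !setTI; congr (mu _ + nu _); apply/setIidr => p [s].
- rewrite /= in_itv/= => /andP[s0 sr] <-; split; rewrite /= in_itv/=;
    by apply/andP; split; lra.
- rewrite /= in_itv/= => /andP[s0 sr] <-; split; rewrite /= in_itv/=.
    by apply/andP; split; lra.
  by rewrite /tent; case: (leP s (r - s)%R) => ss; apply/andP; split; lra.
Qed.

Lemma mr_coherent : coherent m.
Proof.
exact: coherent_of_decomposition mr_setT mr_unit_square mr_decomposition.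
Qed.

End the_extreme_measure.

(** * Marginals of a decomposition *)

Section decomposition_tools.
Local Open Scope ereal_scope.
Context (R : realType).
Implicit Types (m mu nu : {measure set (R * R)%type -> \bar R}).

Lemma addeI_fin (a x y : \bar R) : a \is a fin_num -> a + x = a + y -> x = y.
Proof.
by move=> fa axy; rewrite -(addeK x fa) -(addeK y fa) [x + a]addeC axy [a + y]addeC.
Qed.

Lemma measurable_abs : measurable_fun setT (fun x : R => `|x|%:E).
Proof. by apply/measurable_EFinP; exact: normr_measurable. Qed.

Lemma preimage_fst_measurable (B : set R) : measurable B ->
  measurable (fst @^-1` B : set (R * R)).
Proof. by move=> mB; apply: preimage_measurable => //; exact: measurable_fst. Qed.

Lemma preimage_snd_measurable (B : set R) : measurable B ->
  measurable (snd @^-1` B : set (R * R)).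
Proof. by move=> mB; apply: preimage_measurable => //; exact: measurable_snd. Qed.

Definition marginal1 m : {measure set R -> \bar R} :=
  image_measure m (@measurable_fst _ _ R R).
Definition marginal2 m : {measure set R -> \bar R} :=
  image_measure m (@measurable_snd _ _ R R).

Lemma decomposition_marginal1 m mu nu B : coherent_decomposition m mu nu ->
  measurable B -> marginal1 mu B = \int[marginal1 m]_(x in B) `|x|%:E.
Proof.
move=> [_ H _] mB; rewrite [LHS]H//.
by rewrite (ge0_integral_image_measure m measurable_fst mB measurable_abs).
Qed.

Lemma decomposition_marginal2 m mu nu B : coherent_decomposition m mu nu ->
  measurable B -> marginal2 mu B = \int[marginal2 m]_(x in B) `|x|%:E.
Proof.
move=> [_ _ H] mB; rewrite [LHS]H//.
by rewrite (ge0_integral_image_measure m measurable_snd mB measurable_abs).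
Qed.

Lemma decomposition_convex (t : R) m m1 m2 mu1 mu2 nu1 nu2
    (t0 : (0 <= t)%R) (t1 : (0 <= 1 - t)%R) :
  (forall A, measurable A -> m A = t%:E * m1 A + (1 - t)%:E * m2 A) ->
  coherent_decomposition m1 mu1 nu1 -> coherent_decomposition m2 mu2 nu2 ->
  coherent_decomposition m
    (measure_add (mscale (NngNum t0) mu1) (mscale (NngNum t1) mu2))
    (measure_add (mscale (NngNum t0) nu1) (mscale (NngNum t1) nu2)).
Proof.
move=> mE [E1 F1 S1] [E2 F2 S2].
have mint (f : R * R -> \bar R) D : measurable D ->
    measurable_fun setT f -> (forall p, 0 <= f p) ->
    \int[m]_(p in D) f p =
    t%:E * \int[m1]_(p in D) f p + (1 - t)%:E * \int[m2]_(p in D) f p.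
  move=> mD mf f0.
  transitivity (\int[measure_add (mscale (NngNum t0) m1) (mscale (NngNum t1) m2)]_(p in D) f p).
    apply: eq_measure_integral => A mA _.
    by rewrite mE//; exact/esym/measure_addE.
  have mfD : measurable_fun D f by exact: measurable_funTS.
  by rewrite ge0_integral_measure_add// !ge0_integral_mscale.
split.
- move=> A mA; rewrite mE// E1// E2//.
  rewrite [X in _ = X + _]measure_addE [X in _ = _ + X]measure_addE /mscale/=.
  by rewrite !ge0_muleDr// addeACA.
- move=> B mB; rewrite mint//.
  + by rewrite -F1// -F2//; exact: measure_addE.
  + exact: preimage_fst_measurable.
  + exact: (measurableT_comp measurable_abs measurable_fst).
- move=> B mB; rewrite mint//.
  + by rewrite -S1// -S2//; exact: measure_addE.
  + exact: preimage_snd_measurable.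
  + exact: (measurableT_comp measurable_abs measurable_snd).
Qed.

(** The complementary event has conditional probability [1 - x].  The positive
    part makes the integrand nonnegative outside of [0, r], which carries no
    mass. *)
Lemma decomposition_complement m mu nu (r : R) A : (0 <= r < 1)%R ->
  coherent_decomposition m mu nu -> m setT < +oo ->
  marginal1 m (~` `[0%R, r]%classic) = 0 -> measurable A ->
  marginal1 nu A = \int[marginal1 m]_(x in A) (Num.max (1 - `|x|) 0)%:E.
Proof.
move=> /andP[r0 r1] dec mT m0 mA.
have mg : measurable_fun setT (fun x : R => (Num.max (1 - `|x|) 0)%:E).
  apply/measurable_EFinP; apply: measurable_maxr => //.
  by apply: measurable_funB => //; exact: normr_measurable.
have mI : measurable (`[0%R, r]%classic : set R) by exact: measurable_itv.
have key : marginal1 m A = \int[marginal1 m]_(x in A) `|x|%:E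
    + \int[marginal1 m]_(x in A) (Num.max (1 - `|x|) 0)%:E.
  rewrite -ge0_integralD//; last 2 first.
  - exact: measurable_funTS measurable_abs.
  - exact: measurable_funTS mg.
  have mfun : measurable_fun setT (fun x : R => `|x|%:E + (Num.max (1 - `|x|) 0)%:E).
    exact: emeasurable_funD measurable_abs mg.
  rewrite (ge0_negligible_integral (measurableC mI))//; last 2 first.
  - exact: measurable_funTS.
  - by move=> x _; rewrite adde_ge0// lee_fin// le_max lexx orbT.
  rewrite setDE setCK (eq_integral (cst 1)).
    by rewrite integral_cst ?mul1e; [exact: measure_setI_conull|exact: measurableI].
  move=> x; rewrite inE/= in_itv/= => -[_ /andP[x0 xr]].
  rewrite ger0_norm// max_l ?subr_ge0; last by lra.
  by rewrite -EFinD addrC subrK.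
have fin : marginal1 mu A \is a fin_num.
  case: dec => mE _ _; rewrite ge0_fin_numE//; apply: le_lt_trans mT.
  rewrite mE//; apply: (@le_trans _ _ (mu setT)); last by rewrite leeDl.
  rewrite -[leLHS]/(mu (fst @^-1` A)).
  by apply: le_measure; rewrite ?inE//; exact: preimage_fst_measurable.
have e : marginal1 m A = marginal1 mu A + marginal1 nu A.
  by case: dec => mE _ _; exact: (mE _ (preimage_fst_measurable mA)).
move: key; rewrite e -(decomposition_marginal1 dec mA).
exact: addeI_fin.
Qed.

End decomposition_tools.

(** * Rigidity of the decompositions of m_r *)

Section uniqueness.
Local Open Scope ereal_scope.
Context (R : realType) (r : R).
Hypothesis r01 : (0 < r < 1)%R.
Variables (mu nu : {measure set (R * R)%type -> \bar R}).
Hypotheses (hmu : is_mu r mu) (hnu : is_nu r nu).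

Let m : {measure set (R * R)%type -> \bar R} := measure_add mu nu.
Let c := (norm_const r)^-1%R.
Let K := (c / (1 - r))%R.
Let D := @diag_upto R r.
Let G := @tent_graph_upto R r r.

Let r0 : (0 < r)%R. Proof. by case/andP: r01. Qed.
Let r1 : (r < 1)%R. Proof. by case/andP: r01. Qed.
Let c_gt0 : (0 < c)%R. Proof. by rewrite invr_gt0 norm_const_gt0. Qed.
Let K_gt0 : (0 < K)%R. Proof. by rewrite divr_gt0// subr_gt0. Qed.
Let mt : measurable_fun setT (tent r). Proof. exact: measurable_tent. Qed.
Let mD : measurable D.
Proof. exact: (@measurable_graph_upto R id r (@measurable_id _ _ _)). Qed.
Let mG : measurable G.
Proof. exact: (@measurable_graph_upto R (tent r) r mt). Qed.
Let mI : measurable (`[0%R, r]%classic : set R).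
Proof. exact: measurable_itv. Qed.

Let m_off : m (~` (D `|` G)) = 0.
Proof.
case: hmu => mu0 _; case: hnu => nu0 _.
rewrite [LHS]measure_addE setCU.
rewrite (subset_measure0 _ _ (@subIsetl _ (~` D) (~` G)) mu0) ?add0e//; last 2 first.
- by apply: measurableI; exact: measurableC.
- exact: measurableC.
apply: (subset_measure0 _ _ (@subIsetr _ (~` D) (~` G)) nu0).
- by apply: measurableI; exact: measurableC.
- exact: measurableC.
Qed.

Let marginal1_m_off : marginal1 m (~` `[0%R, r]%classic) = 0.
Proof.
apply: (subset_measure0 _ _ _ m_off).
- by apply: preimage_fst_measurable; exact: measurableC.
- by apply: measurableC; exact: measurableU.
by move=> p /= pr; move=> [] [s sr e]; apply: pr; rewrite -e.
Qed.

(** Off the graph the measure sits on the diagonal, where both projections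
    agree; cancelling that part leaves equal projections on the graph, and there
    the second projection is the tent map of the first. *)
Lemma graph_part_tent_invariant (mu' : {measure set (R * R)%type -> \bar R}) :
  mu' setT < +oo -> mu' (~` (D `|` G)) = 0 ->
  (forall B, measurable B -> mu' (fst @^-1` B) = mu' (snd @^-1` B)) ->
  forall B, measurable B ->
    mu' (fst @^-1` (tent r @^-1` B) `&` G) = mu' (fst @^-1` B `&` G).
Proof.
move=> fin off marg B mB.
have m1 := preimage_fst_measurable mB.
have m2 := preimage_snd_measurable mB.
have mU : measurable (D `|` G) by exact: measurableU.
have same : mu' (fst @^-1` B `\` G) = mu' (snd @^-1` B `\` G).
  rewrite (measure_setI_conull _ mU off); last exact: measurableD.
  rewrite [RHS](measure_setI_conull _ mU off); last exact: measurableD.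
  congr (mu' _); apply/seteqP; split=> p /= [[Bp Gp] [[s sr e]|//]].
    by split; [split => //; move: Bp; rewrite -e|left; exists s].
  by split; [split => //; move: Bp; rewrite -e|left; exists s].
have graph : fst @^-1` (tent r @^-1` B) `&` G = snd @^-1` B `&` G.
  by apply/seteqP; split=> p /= [Bp [s sr e]]; (split; last by exists s);
    move: Bp; rewrite -e.
rewrite graph; apply: (@addeI_fin _ (mu' (fst @^-1` B `\` G))).
  by apply: lty_fin_num_fun_measure => //; exact: measurableD.
by rewrite [in LHS]same -!measureDI//; exact/esym/marg.
Qed.

Section decomposition_of_m.
Variables (mu' nu' : {measure set (R * R)%type -> \bar R}).
Hypothesis dec : coherent_decomposition m mu' nu'.

Let mE A : measurable A -> m A = mu' A + nu' A. Proof. by case: dec => + _ _; exact. Qed.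
Let mu'_le A : measurable A -> mu' A <= m A.
Proof. by move=> mA; rewrite mE// leeDl. Qed.
Let nu'_le A : measurable A -> nu' A <= m A.
Proof. by move=> mA; rewrite mE// leeDr. Qed.

Let mT : m setT = 1. Proof. exact: (mr_setT r01 hmu hnu). Qed.

Let mu'T : mu' setT < +oo.
Proof. by rewrite (le_lt_trans (mu'_le measurableT))// mT ltry. Qed.

Let mu'_off : mu' (~` (D `|` G)) = 0.
Proof.
apply/eqP; rewrite -measure_le0 -m_off; apply: mu'_le.
by apply: measurableC; exact: measurableU.
Qed.

(** The two sides are integrals of the coordinate against the two marginals of
    [m], and these coincide. *)
Lemma mu_part_marginals B : measurable B -> mu' (fst @^-1` B) = mu' (snd @^-1` B).
Proof.
move=> mB; transitivity (marginal1 mu' B) => //; transitivity (marginal2 mu' B) => //.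
rewrite (decomposition_marginal1 dec mB) (decomposition_marginal2 dec mB).
by apply: eq_measure_integral => A mA _; exact/esym/(mr_marginals r01 hmu hnu).
Qed.

(** The projection [al] of the graph part of [mu'] is a multiple of the uniform
    law, so [al] of [0, x] is linear in [x]; but it is also at most [K * x ^ 2],
    because [mu'] has density at most [x] with respect to [m] there. *)
Lemma mu_part_graph_eq0 : mu' G = 0.
Proof.
pose al : {measure set R -> \bar R} := marginal1 (mrestr mu' mG).
have alE B : al B = mu' (fst @^-1` B `&` G) by [].
have al_le B : measurable B -> al B <= mu' (fst @^-1` B).
  move=> mB; rewrite alE; apply: le_measure; rewrite ?inE.
  - by apply: measurableI => //; exact: preimage_fst_measurable.
  - exact: preimage_fst_measurable.
  - exact: subIsetl.
have al_fin : al setT < +oo.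
  exact: le_lt_trans (al_le _ measurableT) mu'T.
have alx : forall x, (0 <= x <= r)%R ->
    al `[0%R, x]%classic = (x / r)%:E * al `[0%R, r]%classic.
  apply: (@tent_invariant_measure _ _ _ K) => //.
    move=> a b ab br; have mab : measurable (`[a, b]%classic : set R) by exact: measurable_itv.
    apply: le_trans (al_le _ mab) _; apply: le_trans (mu'_le (preimage_fst_measurable mab)) _.
    exact: (mr_fst_segment r01 hmu hnu).
  move=> B mB; rewrite !alE; apply: graph_part_tent_invariant => //.
  exact: mu_part_marginals.
have quad x : (0 <= x <= r)%R -> al `[0%R, x]%classic <= (K * x * x)%:E.
  move=> /andP[x0 xr]; have mx : measurable (`[0%R, x]%classic : set R) by exact: measurable_itv.
  rewrite (le_trans (al_le _ mx))// -[leLHS]/(marginal1 mu' _).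
  rewrite (decomposition_marginal1 dec mx).
  apply: (@le_trans _ _ (\int[marginal1 m]_(y in `[0%R, x]) x%:E)).
    apply: ge0_le_integral => //.
    - by apply: measurable_funTS; exact: measurable_abs.
    - by move=> y /=; rewrite in_itv/= lee_fin => /andP[y0 yx]; rewrite ger0_norm.
  rewrite integral_cst//= [X in _ <= X%:E]mulrC EFinM lee_wpmul2l ?lee_fin//.
  have x0x : (0 <= (0 : R) <= x)%R by rewrite lexx.
  by have := mr_fst_segment r01 hmu hnu x0x xr; rewrite subr0.
have [a aE] : exists a, al `[0%R, r]%classic = a%:E.
  exists (fine (al `[0%R, r]%classic)); rewrite fineK//.
  exact: (lty_fin_num_fun_measure al_fin).
have a_ge0 : (0 <= a)%R by rewrite -lee_fin -aE.
have alr0 : al `[0%R, r]%classic = 0.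
  rewrite aE; congr EFin; apply/eqP; rewrite eq_le a_ge0 andbT leNgt; apply/negP => a0.
  pose x : R := (Num.min r (a / (2 * r * K)))%R.
  (* [x] is small enough for the quadratic bound [K * x ^ 2] to fall below the
     linear value [a * x / r]. *)
  have x0 : (0 < x)%R.
    rewrite lt_min; apply/andP; split; first exact: r0.
    exact: (divr_gt0 a0 (mulr_gt0 (mulr_gt0 (ltr0Sn _ 1) r0) K_gt0)).
  have xr : (x <= r)%R by rewrite ge_min lexx.
  have x0r : (0 <= x <= r)%R by rewrite (ltW x0).
  have := quad x x0r; rewrite alx// aE -EFinM lee_fin.
  have xK : (K * x <= a / r / 2)%R.
    have : (x <= a / (2 * r * K))%R by rewrite ge_min lexx orbT.
    have split_div (k : R) : (k != 0 -> a / (2 * r * k) = a / r / 2 / k)%R.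
      by move=> k0; field; rewrite k0 gt_eqF.
    rewrite split_div ?gt_eqF// => xle.
    by rewrite [leLHS]mulrC -ler_pdivlMr.
  rewrite [X in (X <= _)%R](_ : _ = a / r * x)%R; last by ring.
  rewrite ler_pM2r//; apply/negP; rewrite -ltNge.
  apply: le_lt_trans xK _.
  by rewrite gtr_pMr ?divr_gt0// invf_lt1// ltr1n.
rewrite (_ : G = fst @^-1` `[0%R, r]%classic `&` G); last first.
  by apply/esym/setIidr => p [s sr <-].
exact: alr0.
Qed.

Lemma mu_part_off_diag : mu' (~` D) = 0.
Proof.
have sub : ~` D `<=` ~` (D `|` G) `|` G.
  move=> p nD; have [Gp|nG] := pselect (G p); first by right.
  by left => -[].
apply: (subset_measure0 _ _ sub).
- exact: measurableC.
- by apply: measurableU => //; apply: measurableC; exact: measurableU.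
apply: null_set_setU => //; last exact: mu_part_graph_eq0.
by apply: measurableC; exact: measurableU.
Qed.

(** [mu'] and [mu] have the same total mass, hence so have [nu'] and [nu]; as
    [mu'] ignores the graph, [nu'] has there all the mass of [m], which is at
    least the total mass of [nu]. *)
Lemma nu_part_off_graph : nu' (~` G) = 0.
Proof.
have fin (p : {measure set (R * R)%type -> \bar R}) : p setT <= m setT ->
    forall A, measurable A -> p A \is a fin_num.
  move=> pm; apply: lty_fin_num_fun_measure.
  by apply: le_lt_trans pm _; rewrite mT ltry.
have muT : mu' setT = mu setT.
  case: dec => _ /(_ setT measurableT) -> _.
  by case: (mr_decomposition r01 hmu hnu) => _ /(_ setT measurableT) ->.
have mu'_fin := fin mu' (mu'_le measurableT).
have mEm A : m A = mu A + nu A by exact: measure_addE.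
have mu_fin : mu setT \is a fin_num by rewrite -muT; exact: mu'_fin.
have nuT : nu' setT = nu setT.
  by apply: (@addeI_fin _ (mu setT)) => //; rewrite -{1}muT -mE// mEm.
have nuG : nu setT <= nu' G.
  case: hnu => nu0 _; rewrite (measure_setI_conull measurableT mG nu0) setTI.
  have : nu G <= m G by rewrite mEm leeDr.
  by rewrite mE// mu_part_graph_eq0 add0e.
have nu'_fin := fin nu' (nu'_le measurableT).
have tot : nu' setT = nu' (~` G) + nu' G.
  by rewrite (measureDI nu' measurableT mG) setTD setTI.
apply/eqP; rewrite -measure_le0.
have nGf : nu' G \is a fin_num by exact: nu'_fin.
rewrite -(leeD2rE _ _ nGf) add0e.
have : nu' setT <= nu' G by rewrite nuT.
by rewrite tot.
Qed.

End decomposition_of_m.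

(** With the event part on the diagonal and the other part on the graph, the
    coherence identities become a closed system: the projection of [nu1] is
    invariant under the tent map, hence [q] times that of [nu]; its density with
    respect to the marginal of [m1] is [1 - x], so that marginal is [q] times
    the marginal of [m]; total mass gives [q = 1]. *)
Lemma rigid_decomposition (C : R) (m1 mu1 nu1 : {measure set (R * R)%type -> \bar R}) :
  (0 <= C)%R -> m1 setT = 1 ->
  (forall A, measurable A -> m1 A <= C%:E * m A) ->
  coherent_decomposition m1 mu1 nu1 -> mu1 (~` D) = 0 -> nu1 (~` G) = 0 ->
  forall A, measurable A -> m1 A = m A.
Proof.
move=> C0 m1T m1le dec1 mu1D nu1G.
have [m1E _ _] := dec1.
have dec := mr_decomposition r01 hmu hnu.
have mT : m setT = 1 := mr_setT r01 hmu hnu.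
have m1fin : m1 setT < +oo by rewrite m1T ltry.
have marg_le A : measurable A -> marginal1 m1 A <= C%:E * marginal1 m A.
  by move=> mA; exact: (m1le _ (preimage_fst_measurable mA)).
have seg0 : marginal1 m [set 0%R] = 0.
  apply/eqP; rewrite -measure_le0 -set_itv1.
  have h : (0 <= (0 : R) <= 0)%R by rewrite lexx.
  by have := mr_fst_segment r01 hmu hnu h (ltW r0); rewrite subrr mulr0.
have zero1 : marginal1 m1 [set 0%R] = 0.
  apply/eqP; rewrite -measure_le0; apply: le_trans (marg_le _ _) _.
    exact: measurable_set1.
  by rewrite seg0 mule0.
have zero2 : marginal2 m1 [set 0%R] = 0.
  have m0 : measurable ([set 0%R] : set R) by exact: measurable_set1.
  apply/eqP; rewrite -measure_le0.
  apply: le_trans (m1le _ (preimage_snd_measurable m0)) _.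
  by rewrite (mr_marginals r01 hmu hnu m0) -[m _]/(marginal1 m _) seg0 mule0.
have int_fin : \int[marginal1 m1]_x `|x|%:E < +oo.
  rewrite -(decomposition_marginal1 dec1 measurableT).
  apply: le_lt_trans m1fin; rewrite m1E//.
  by rewrite -[leLHS]/(mu1 setT) leeDl.
have mu1_marg A : measurable A -> marginal1 mu1 A = marginal2 mu1 A.
  by move=> mA; rewrite [RHS](graph_measure_snd (@measurable_id _ _ _) mu1D).
(* The density [x] can be cancelled away from the origin, and the origin has no
   mass because [m1] is dominated by a multiple of [m]. *)
have margE A : measurable A -> marginal1 m1 A = marginal2 m1 A.
  move=> mA.
  have m0 : measurable (~` [set 0%R] : set R).
    by apply: measurableC; exact: measurable_set1.
  rewrite (measure_setI_conull mA m0); last by rewrite setCK.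
  rewrite [RHS](measure_setI_conull mA m0); last by rewrite setCK.
  apply: (@eq_density_measure _ _ _ (marginal1 m1) (marginal2 m1) (fun x : R => `|x|%R)) => //.
  - move=> B mB; rewrite -(decomposition_marginal1 dec1 mB).
    by rewrite mu1_marg// (decomposition_marginal2 dec1 mB).
  - exact: measurableI.
  - by move=> x [_ /= /eqP x0]; rewrite normr_gt0.
have nu1_tent B : measurable B -> marginal1 nu1 (tent r @^-1` B) = marginal1 nu1 B.
  move=> mB; transitivity (marginal2 nu1 B).
    by apply/esym; exact: (graph_measure_snd mt nu1G).
  have mu1B : marginal1 mu1 B \is a fin_num.
    rewrite ge0_fin_numE//; apply: le_lt_trans m1fin.
    apply: (@le_trans _ _ (m1 (fst @^-1` B))).
      by rewrite (m1E _ (preimage_fst_measurable mB)) leeDl.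
    by apply: le_measure; rewrite ?inE//; exact: preimage_fst_measurable.
  apply: (addeI_fin mu1B).
  transitivity (marginal2 m1 B).
    by rewrite mu1_marg//; apply/esym; exact: (m1E _ (preimage_snd_measurable mB)).
  by rewrite -margE//; exact: (m1E _ (preimage_fst_measurable mB)).
have nu1_le A : measurable A -> marginal1 nu1 A <= marginal1 m1 A.
  move=> mA; rewrite -[leRHS]/(m1 (fst @^-1` A)).
  by rewrite (m1E _ (preimage_fst_measurable mA)) leeDr.
have nu1_fin : marginal1 nu1 setT < +oo.
  exact: le_lt_trans (nu1_le _ measurableT) m1fin.
have nu1x : forall x, (0 <= x <= r)%R -> marginal1 nu1 `[0%R, x]%classic =
    (x / r)%:E * marginal1 nu1 `[0%R, r]%classic.
  apply: (@tent_invariant_measure _ _ _ (C * K)%R) => //.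
  move=> a b ab br; have mab : measurable (`[a, b]%classic : set R) by exact: measurable_itv.
  apply: le_trans (nu1_le _ mab) _; apply: le_trans (marg_le _ mab) _.
  rewrite -mulrA EFinM lee_wpmul2l ?lee_fin//.
  exact: (mr_fst_segment r01 hmu hnu).
have [a aE] : exists a, marginal1 nu1 `[0%R, r]%classic = a%:E.
  exists (fine (marginal1 nu1 `[0%R, r]%classic)); rewrite fineK//.
  exact: (lty_fin_num_fun_measure nu1_fin).
have a_ge0 : (0 <= a)%R by rewrite -lee_fin -aE.
have q0 : (0 <= a / (c * r))%R by rewrite divr_ge0// mulr_ge0// ltW.
pose q := NngNum q0.
have rr : (0 <= r <= r)%R by rewrite lexx ltW.
have nuseg x : (0 <= x <= r)%R -> marginal1 nu `[0%R, x]%classic = (c * x)%:E.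
  move=> /andP[x0 xr]; have h : (0 <= (0 : R) <= x)%R by rewrite lexx.
  by have := nu_fst_segment r01 hnu h xr; rewrite subr0.
have nu1_off : marginal1 nu1 (~` `[0%R, r]%classic) = 0.
  apply/eqP; rewrite -measure_le0.
  apply: le_trans (nu1_le _ (measurableC mI)) _.
  by apply: le_trans (marg_le _ (measurableC mI)) _; rewrite marginal1_m_off mule0.
have nu_off : marginal1 nu (~` `[0%R, r]%classic) = 0.
  apply/eqP; rewrite -measure_le0 -marginal1_m_off.
  by rewrite -[leRHS]/(m _) [leRHS]measure_addE leeDr.
have nu1E A : measurable A -> marginal1 nu1 A = mscale q (marginal1 nu) A.
  apply: (@eq_measure_segment _ _ _ r) => //.
  - exact: ltW.
  - by rewrite /= /mscale nu_off mule0.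
  - by rewrite aE ltry.
  move=> x xr; rewrite nu1x// aE /= /mscale nuseg// -!EFinM; congr EFin => /=.
  have cancel_div (k : R) : (k != 0 -> x / r * a = a / (k * r) * (k * x))%R.
    by move=> k0; field; rewrite k0 gt_eqF.
  by apply: cancel_div; rewrite gt_eqF.
have m1_off : marginal1 m1 (~` `[0%R, r]%classic) = 0.
  apply/eqP; rewrite -measure_le0.
  by apply: le_trans (marg_le _ (measurableC mI)) _; rewrite marginal1_m_off mule0.
have r01' : (0 <= r < 1)%R by rewrite ltW.
have mfin : m setT < +oo by rewrite mT ltry.
have mg : measurable_fun setT (fun x : R => Num.max (1 - `|x|) 0)%R.
  apply: measurable_maxr => //.
  by apply: measurable_funB => //; exact: normr_measurable.
have g0 (x : R) : (0 <= Num.max (1 - `|x|) 0)%R by rewrite le_max lexx orbT.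
have m1q A : measurable A -> marginal1 m1 A = mscale q (marginal1 m) A.
  move=> mA.
  have qoff : mscale q (marginal1 m) (~` `[0%R, r]%classic) = 0.
    by rewrite /mscale marginal1_m_off mule0.
  rewrite (measure_setI_conull mA mI m1_off) (measure_setI_conull mA mI qoff).
  apply: (@eq_density_measure _ _ _ (marginal1 m1) (mscale q (marginal1 m))
    (fun x : R => Num.max (1 - `|x|) 0)%R) => //.
  - by rewrite /= /mscale -[marginal1 m _]/(m setT) mT mule1 ltry.
  - rewrite -(decomposition_complement r01' dec1 m1fin m1_off measurableT).
    exact: nu1_fin.
  - move=> B mB; rewrite -(decomposition_complement r01' dec1 m1fin m1_off mB).
    rewrite ge0_integral_mscale//; last first.
      by apply: measurable_funTS; exact/measurable_EFinP.
    rewrite -(decomposition_complement r01' dec mfin marginal1_m_off mB).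
    exact: nu1E.
  - exact: measurableI.
  - move=> x [_ /=]; rewrite in_itv/= => /andP[x0 xr].
    by rewrite lt_max ger0_norm// subr_gt0 (le_lt_trans xr).
have q1 : q%:num%:E = 1 :> \bar R.
  by rewrite -m1T -[LHS]mule1 -mT; exact/esym/(m1q _ measurableT).
have margm A : measurable A -> marginal1 m1 A = marginal1 m A.
  by move=> mA; rewrite m1q// /= /mscale q1 mul1e.
move=> A mA.
have mS1 := measurable_section (@measurable_id _ _ _) mA.
have mS2 := measurable_section mt mA.
rewrite m1E// [RHS]measure_addE.
case: hmu => mu0 _; case: hnu => nu0 _.
congr (_ + _).
- rewrite (graph_measure_section (@measurable_id _ _ _) mu1D mA).
  rewrite [RHS](graph_measure_section (@measurable_id _ _ _) mu0 mA).
  rewrite -[LHS]/(marginal1 mu1 _) -[RHS]/(marginal1 mu _).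
  rewrite (decomposition_marginal1 dec1 mS1) (decomposition_marginal1 dec mS1).
  by apply: eq_measure_integral => B mB _; exact: margm.
- rewrite (graph_measure_section mt nu1G mA) [RHS](graph_measure_section mt nu0 mA).
  rewrite -[LHS]/(marginal1 nu1 _) -[RHS]/(marginal1 nu _).
  by rewrite nu1E// /= /mscale q1 mul1e.
Qed.

End uniqueness.

(** * Extremality *)

Section convex_combinations.
Local Open Scope ereal_scope.
Context (R : realType).

Lemma convex_combination_eq0 (t : R) (x y : \bar R) : (0 < t < 1)%R ->
  0 <= x -> 0 <= y -> t%:E * x + (1 - t)%:E * y = 0 -> x = 0 /\ y = 0.
Proof.
move=> /andP[t0 t1] x0 y0 /eqP.
rewrite padde_eq0 ?mule_ge0 ?lee_fin ?subr_ge0 ?(ltW t0) ?(ltW t1)//.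
rewrite !mule_eq0 !eqe (gt_eqF t0) subr_eq0 (gt_eqF t1)/=.
by move=> /andP[/eqP -> /eqP ->].
Qed.

Lemma le_convex_combination (t : R) (x y z : \bar R) : (0 < t < 1)%R -> 0 <= y ->
  z = t%:E * x + (1 - t)%:E * y -> x <= t^-1%:E * z.
Proof.
move=> /andP[t0 t1] y0 ->.
have e : t^-1%:E * (t%:E * x) = x by rewrite muleA -EFinM mulVf ?mul1e// gt_eqF.
rewrite -[leLHS]e.
apply: lee_wpmul2l; first by rewrite lee_fin invr_ge0 ltW.
by rewrite leeDl// mule_ge0// lee_fin subr_ge0 (ltW t1).
Qed.
End convex_combinations.

Theorem theorem1p1 (R : realType) (r : R)
    (mu_r nu_r : {measure set (R * R)%type -> \bar R}) :
  0 < r < 1 -> is_mu r mu_r -> is_nu r nu_r ->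
  extreme_point coherent (measure_add mu_r nu_r).
Proof.
move=> r01 hmu hnu; split; first exact: (mr_coherent r01 hmu hnu).
move=> m1 m2 t C1 C2 t01 mE.
have [t0 t1] := andP t01.
have t0' : 0 <= t by exact: ltW.
have t1' : 0 <= 1 - t by rewrite subr_ge0 ltW.
have t1p : 0 < 1 - t by rewrite subr_gt0.
have [mu1 [nu1 dec1]] := coherent_decompose C1.
have [mu2 [nu2 dec2]] := coherent_decompose C2.
have dec := decomposition_convex t0' t1' mE dec1 dec2.
have muD := mu_part_off_diag r01 hmu hnu dec.
have nuG := nu_part_off_graph r01 hmu hnu dec.
have [mu1D mu2D] : mu1 (~` diag_upto r) = 0%E /\ mu2 (~` diag_upto r) = 0%E.
  apply: (convex_combination_eq0 t01) => //.
  by rewrite -muD; apply/esym; exact: measure_addE.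
have [nu1G nu2G] : nu1 (~` tent_graph_upto r r) = 0%E /\ nu2 (~` tent_graph_upto r r) = 0%E.
  apply: (convex_combination_eq0 t01) => //.
  by rewrite -nuG; apply/esym; exact: measure_addE.
have [m1T _ _] := C1; have [m2T _ _] := C2.
(* The combination is symmetric in [m1] and [m2]; exchanging them turns [t] into
   [1 - t]. *)
have mE' A : measurable A -> (measure_add mu_r nu_r A = (1 - t)%:E * m2 A + (1 - (1 - t))%:E * m1 A)%E.
  by move=> mA; rewrite subKr addeC; exact: mE.
have t01' : 0 < 1 - t < 1 by rewrite t1p ltrBlDr ltrDl.
move=> A mA; split.
- apply: (rigid_decomposition r01 hmu hnu (C := t^-1) _ m1T _ dec1) => //.
    by rewrite invr_ge0.
  by move=> B mB; apply: (le_convex_combination t01 _ (mE _ mB)).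
- apply: (rigid_decomposition r01 hmu hnu (C := (1 - t)^-1) _ m2T _ dec2) => //.
    by rewrite invr_ge0.
  by move=> B mB; apply: (le_convex_combination t01' _ (mE' _ mB)).
Qed.
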